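(* Let $G$ be a finite group, $(\rho,V)$ a non-trivial irreducible real representation of $G$ of Frobenius–Schur type $D\in\{\mathbb{R},\mathbb{C},\mathbb{H}\}$, $d=\dim_{\mathbb{R}}D$, $V\cong D^n$, with $\rho:G\to \mathrm{O}_D(n)$ the corresponding $D$-linear matrix representation. Let $1\le m\le n$, and let $M\in\mathrm{Mat}_{n\times m}(D)$ have Frobenius norm $\|M\|_F=1$, with $G$ acting on $\mathrm{Mat}_{n\times m}(D)$ by left multiplication via $\rho$. Then the orbit $$GM:=\{\rho(g)M \mid g\in G\}$$ is a spherical 2-design in $\mathrm{Mat}_{n\times m}(D)\cong\mathbb{R}^{nmd}$ if and only if $$\overline{M}^\top M=\frac1m I_m .$$ In particular, for $m=n$, this holds if and only if $M=\frac{1}{\sqrt n}U$ for some $U\in\mathrm{O}_D(n)$. Moreover, every spherical 2-design orbit in a nonzero real subrepresentation of $\mathrm{Mat}_{n\times n}(D)$, where the subrepresentation is identified with $\mathrm{Mat}_{n\times m}(D)$ by a $G$-equivariant linear isometry, arises as the image $$\pi_{n,m}^D\Big(\Big\{\tfrac{1}{\sqrt m}\,\rho(g)U \;\Big|\; g\in G\Big\}\Big)\quad\text{for some } U\in\mathrm{O}_D(n).$$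
   Context: Setting: $D=\mathrm{End}_G(V)^{\mathrm{op}}\in\{\mathbb{R},\mathbb{C},\mathbb{H}\}$, $V$ is viewed as a right $D$-module with a $G$-invariant $D$-valued Hermitian inner product and an orthonormal $D$-basis, giving $V\cong D^n$ and a matrix representation $\rho$ of $G$ acting by left multiplication with values in $\mathrm{O}_D(n)=\{U\in\mathrm{Mat}_{n\times n}(D):\overline U^\top U=I_n\}$ (bar is entrywise conjugation in $D$). The space $\mathrm{Mat}_{n\times n}(D)$ with $G$ acting by left multiplication via $\rho$ is isomorphic to the $V$-isotypic component of $\mathbb{R}[G]$. The space $\mathrm{Mat}_{n\times m}(D)$ is viewed as the subspace of the first $m$ columns; it is a $G$-representation isomorphic to $V^m$, and $\pi_{n,m}^D:\mathrm{Mat}_{n\times n}(D)\to\mathrm{Mat}_{n\times m}(D)$ is the orthogonal projection keeping the first $m$ columns. Every nonzero subrepresentation of $\mathrm{Mat}_{n\times n}(D)$ is $G$-equivariantly isometric to $\mathrm{Mat}_{n\times m}(D)$ for some $1\le m\le n$. The Frobenius norm is $\|M\|_F^2=\sum_{k,l}|M_{kl}|^2$, and $\mathrm{Mat}_{n\times m}(D)$ is identified with Euclidean space $\mathbb{R}^{nmd}$ via real coordinates with respect to the standard real basis of $D$ ($\{1\}$, $\{1,\mathbf i\}$ or $\{1,\mathbf i,\mathbf j,\mathbf k\}$). A finite subset $X$ of the unit sphere $S(E)$ of a Euclidean space $E$ is a spherical $t$-design if $\frac{1}{|X|}\sum_{x\in X} f(x)=\int_{S(E)} f\,d\mu$ for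 all real polynomial functions $f$ on $E$ of degree at most $t$, where $\mu$ is the normalized rotation-invariant measure. For an orbit $Gv$ of a unit vector, being a 2-design amounts to $\sum_{g} gv=0$ and $\frac{1}{|G|}\sum_{g}(gv)(gv)^\top=\frac{1}{\dim E}I_E$. *)

(* Defs.v *)
From HB Require Import structures.
From mathcomp Require Import all_boot all_order all_algebra.
From mathcomp Require Import fingroup mxrepresentation.
From mathcomp Require mpoly.
From mathcomp Require Import ring.
From mathcomp Require Import complex finmap.
From mathcomp Require Import all_classical all_reals all_analysis.

Set Implicit Arguments.
Unset Strict Implicit.
Unset Printing Implicit Defensive.

Import Order.TTheory GRing.Theory Num.Theory.
Import numFieldNormedType.Exports.

Local Open Scope classical_set_scope.
Local Open Scope ring_scope.

(* Quaternion a b c d stands for a + b i + c j + d k. *)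
Record quaternion (R : Type) := Quaternion { qre : R; qi : R; qj : R; qk : R }.

Section QuaternionRing.
Variable R : comNzRingType.
Implicit Types x y z : quaternion R.

Definition quaternion_tuple x := (qre x, qi x, qj x, qk x).
Definition tuple_quaternion (u : R * R * R * R) :=
  Quaternion u.1.1.1 u.1.1.2 u.1.2 u.2.
Lemma quaternion_tupleK : cancel quaternion_tuple tuple_quaternion.
Proof. by case. Qed.

HB.instance Definition _ :=
  Choice.copy (quaternion R) (can_type quaternion_tupleK).

Definition qzero : quaternion R := Quaternion 0 0 0 0.
Definition qone : quaternion R := Quaternion 1 0 0 0.
Definition qopp x := Quaternion (- qre x) (- qi x) (- qj x) (- qk x).
Definition qadd x y :=
  Quaternion (qre x + qre y) (qi x + qi y) (qj x + qj y) (qk x + qk y).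
Definition qmul x y := Quaternion
  (qre x * qre y - qi x * qi y - qj x * qj y - qk x * qk y)
  (qre x * qi y + qi x * qre y + qj x * qk y - qk x * qj y)
  (qre x * qj y - qi x * qk y + qj x * qre y + qk x * qi y)
  (qre x * qk y + qi x * qj y - qj x * qi y + qk x * qre y).
Definition qconj x := Quaternion (qre x) (- qi x) (- qj x) (- qk x).

Lemma qaddA : associative qadd.
Proof. by move=> x y z; rewrite /qadd /= !addrA. Qed.
Lemma qaddC : commutative qadd.
Proof.
by move=> x y; congr Quaternion; rewrite /= addrC.
Qed.
Lemma qadd0 : left_id qzero qadd.
Proof. by case=> a b c d; rewrite /qadd /= !add0r. Qed.
Lemma qaddN : left_inverse qzero qopp qadd.
Proof. by case=> a b c d; rewrite /qadd /= !addNr. Qed.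

HB.instance Definition _ :=
  GRing.isZmodule.Build (quaternion R) qaddA qaddC qadd0 qaddN.

Lemma qmulA : associative qmul.
Proof. by move=> x y z; congr Quaternion => /=; ring. Qed.
Lemma qmul1l : left_id qone qmul.
Proof. by case=> a b c d; congr Quaternion => /=; ring. Qed.
Lemma qmul1r : right_id qone qmul.
Proof. by case=> a b c d; congr Quaternion => /=; ring. Qed.
Lemma qmulDl : left_distributive qmul +%R.
Proof. by move=> x y z; congr Quaternion => /=; ring. Qed.
Lemma qmulDr : right_distributive qmul +%R.
Proof. by move=> x y z; congr Quaternion => /=; ring. Qed.
Lemma qone_neq0 : qone != 0.
Proof. by apply/eqP => -[] /eqP; rewrite oner_eq0. Qed.

HB.instance Definition _ := GRing.Zmodule_isNzRing.Build (quaternion R)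
  qmulA qmul1l qmul1r qmulDl qmulDr qone_neq0.

End QuaternionRing.

(* Frobenius-Schur types; fs_alg R t below is the division algebra D of type t. *)
Inductive fs_type := FSreal | FScomplex | FSquaternion.

Definition fs_dim (t : fs_type) : nat :=
  match t with FSreal => 1 | FScomplex => 2 | FSquaternion => 4 end.

Definition fs_alg (R : realType) (t : fs_type) : nzRingType :=
  match t with
  | FSreal => (R : nzRingType)
  | FScomplex => (complex R : nzRingType)
  | FSquaternion => (quaternion R : nzRingType)
  end.

Definition fs_real (R : realType) (t : fs_type) : R -> fs_alg R t :=
  match t return R -> fs_alg R t with
  | FSreal => fun c => c
  | FScomplex => fun c => Complex c 0
  | FSquaternion => fun c => Quaternion c 0 0 0
  end.

Definition fs_conj (R : realType) (t : fs_type) : fs_alg R t -> fs_alg R t :=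
  match t return fs_alg R t -> fs_alg R t with
  | FSreal => fun x => x
  | FScomplex => fun x : complex R => conjc x
  | FSquaternion => fun x : quaternion R => qconj x
  end.

Definition fs_coord (R : realType) (t : fs_type) :
    fs_alg R t -> 'rV[R]_(fs_dim t) :=
  match t return fs_alg R t -> 'rV[R]_(fs_dim t) with
  | FSreal => fun x : R => \row_(_ < 1) x
  | FScomplex => fun x : complex R =>
      \row_(j < 2) [:: complex.Re x; complex.Im x]`_j
  | FSquaternion => fun x : quaternion R =>
      \row_(j < 4) [:: qre x; qi x; qj x; qk x]`_j
  end.

Section Matrices.
Variables (R : realType) (t : fs_type).
Local Notation D := (fs_alg R t).
Local Notation d := (fs_dim t).

Definition fs_normsq (x : D) : R := \sum_j fs_coord x 0 j ^+ 2.

Definition adjmx p q (A : 'M[D]_(p, q)) : 'M[D]_(q, p) :=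
  (map_mx (@fs_conj R t) A)^T.

Definition unitary_fs n (U : 'M[D]_n) : Prop := adjmx U *m U = 1%:M.

Definition frobenius p q (A : 'M[D]_(p, q)) : R :=
  Num.sqrt (\sum_k \sum_l fs_normsq (A k l)).

Definition scale_real (c : R) p q (A : 'M[D]_(p, q)) : 'M[D]_(p, q) :=
  fs_real t c *: A.

Definition realvec p q (A : 'M[D]_(p, q)) : 'rV[R]_(p * q * d) :=
  mxvec (\matrix_(k < p * q) fs_coord (mxvec A 0 k)).

Definition first_cols n m (hmn : (m <= n)%N) (A : 'M[D]_n) : 'M[D]_(n, m) :=
  colsub (widen_ord hmn) A.

End Matrices.

Section Representation.
Variables (R : realType) (gT : finGroupType) (G : {group gT}).
Variables (t : fs_type) (N : nat) (rG : mx_representation R G N).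
Local Notation D := (fs_alg R t).
Local Notation V := 'rV[R]_N.

(* MathComp matrix representations act on row vectors on the right; the left
   G-module they define is g . v = v *m rG g^-1, with the same subrepresentations
   and the same endomorphisms v |-> v *m A (A such that centgmx rG A). *)
Definition lact (g : gT) (v : V) : V := v *m rG (g^-1)%g.

(* Since v *m A *m B applies A first, the product of 'M[R]_N acting on row
   vectors is the product of End(V)^op: delta is an isomorphism of R-algebras
   D -> End_G(V)^op, and v *m delta x is the right D-module structure of V. *)
Definition fs_iso (delta : D -> 'M[R]_N) : Prop :=
  [/\ forall x y, delta (x + y) = delta x + delta y,
      forall x y, delta (x * y) = delta x *m delta y,
      forall c : R, delta (fs_real t c) = c%:M,
      injective delta &
      forall A, centgmx rG A <-> exists x, delta x = A].

(* h is D-linear in its second argument, so h (v . x) w = conj x * h v w. *)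
Definition invariant_hermitian (delta : D -> 'M[R]_N) (h : V -> V -> D) : Prop :=
  [/\ forall u v w, h u (v + w) = h u v + h u w,
      forall u v x, h u (v *m delta x) = h u v * x,
      forall u v, h v u = fs_conj (h u v),
      forall v, v != 0 -> exists2 c : R, 0 < c & h v v = fs_real t c &
      forall g, g \in G -> forall u v, h (lact g u) (lact g v) = h u v].

Definition orthonormal_Dbasis n (delta : D -> 'M[R]_N) (h : V -> V -> D)
    (e : 'I_n -> V) : Prop :=
  (forall i j, h (e i) (e j) = (i == j)%:R) /\
  (forall v, exists c : 'I_n -> D, v = \sum_i e i *m delta (c i)).

(* The matrix of v |-> g . v on coordinates: g . e_j = \sum_i e_i rho(g)_ij. *)
Definition Dmatrix n (h : V -> V -> D) (e : 'I_n -> V) (g : gT) : 'M[D]_n :=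
  \matrix_(i, j) h (e i) (lact g (e j)).

Section Orbits.
Variables (n : nat) (rho : gT -> 'M[D]_n).

Definition orbit_mx m (A : 'M[D]_(n, m)) : set 'M[D]_(n, m) :=
  [set B | exists2 g, g \in G & B = rho g *m A].

Definition subrep (W : {vspace 'rV[R]_(n * n * fs_dim t)}) : Prop :=
  forall g (A : 'M[D]_n), g \in G -> realvec A \in W -> realvec (rho g *m A) \in W.

(* phi restricts to a G-equivariant R-linear isometry of W onto Mat_{n x m}(D);
   its values outside W are irrelevant. *)
Definition equivariant_isometry (W : {vspace 'rV[R]_(n * n * fs_dim t)}) m
    (phi : 'M[D]_n -> 'M[D]_(n, m)) : Prop :=
  let inW (A : 'M[D]_n) := realvec A \in W in
  [/\ forall A B, inW A -> inW B -> phi (A + B) = phi A + phi B,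
      forall (c : R) A, inW A -> phi (scale_real c A) = scale_real c (phi A),
      forall A, inW A -> frobenius (phi A) = frobenius A,
      forall B, exists2 A, inW A & phi A = B &
      forall g A, g \in G -> inW A -> phi (rho g *m A) = rho g *m phi A].

End Orbits.
End Representation.

Section SphericalDesigns.
Variables (R : realType) (N : nat).
(* Euclidean spaces are the subspaces E of R^N with the standard inner product
   (the norm `|x| of MathComp-Analysis on 'rV[R]_N is the sup norm). *)
Variable E : {vspace 'rV[R]_N}.

Definition dotv (x y : 'rV[R]_N) : R := \sum_i x 0 i * y 0 i.

Definition unit_sphere : set 'rV[R]_N := [set x | x \in E /\ dotv x x = 1].

Definition borel_rV := g_sigma_algebraType (@open 'rV[R]_N).

(* mu is the normalized rotation-invariant measure of the sphere of E, viewed as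
   a Borel measure on R^N. Rotations are all linear isometries of E, so that
   the sphere {x, -x} of a line carries a unique such measure. *)
Definition uniform_on_sphere (mu : probability borel_rV R) : Prop :=
  mu (unit_sphere : set borel_rV) = 1%E /\
  forall A : 'M[R]_N,
    (forall x, x \in E -> x *m A \in E /\ dotv (x *m A) (x *m A) = dotv x x) ->
    forall B : set borel_rV, measurable B ->
      mu ((fun x : 'rV[R]_N => x *m A) @^-1` B) = mu B.

(* The polynomial functions of degree at most k on E are the restrictions of
   those on R^N. *)
Definition spherical_design (mu : probability borel_rV R) (k : nat)
    (X : set 'rV[R]_N) : Prop :=
  [/\ finite_set X, X !=set0, X `<=` unit_sphere &
      forall p : mpoly.mpoly N R,
        all (fun a => (mpoly.mdeg a <= k)%N) (mpoly.msupp p) ->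
        let f (x : 'rV[R]_N) : R := mpoly.meval (fun i => x 0 i) p in
        (((#|` fset_set X|%:R)^-1 * \sum_(x \in X) f x)%:E
         = \int[mu]_(x in (unit_sphere : set borel_rV)) (f x)%:E)%E].

End SphericalDesigns.

(* Main.v *)
(* Identify V with D^n through the orthonormal basis. For u, w in V the operator
   v |-> sum_g Re h(g u, v) (g w) commutes with G, so by Schur's lemma it is a right
   multiplication by some s in D; comparing the traces of its products with right
   multiplications by scalars gives s = (|G| / dim V) h(u, w). Column by column, the
   second moment operator B |-> sum_g <rho(g) M, B> rho(g) M of the orbit of M is
   B |-> (|G| / dim V) B M^* M. Reflections show that the second moment of the sphere
   is a scalar, so the orbit is a 2-design exactly when M^* M is a scalar, which is 1/m
   since M has norm 1; the first moment vanishes because V has no nonzero fixed vector.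
   An equivariant isometry transports second moments, and the columns of sqrt(m) M,
   being orthonormal, are the first m columns of a unitary matrix. *)
Require Import Defs.
From HB Require Import structures.
From mathcomp Require Import all_boot all_order all_algebra.
From mathcomp Require Import fingroup mxrepresentation.
From mathcomp Require mpoly.
From mathcomp Require Import ring lra.
From mathcomp Require Import complex finmap.
From mathcomp Require Import all_classical all_reals all_analysis.
From mathcomp Require Import measurable_realfun.

Set Implicit Arguments.
Unset Strict Implicit.
Unset Printing Implicit Defensive.

Import Order.TTheory GRing.Theory Num.Theory.
Import numFieldNormedType.Exports.

Local Open Scope classical_set_scope.
Local Open Scope ring_scope.

(** * Real part, conjugation and real coordinates on the division algebra D *)

Section DivisionAlgebra.
Variables (R : realType) (t : fs_type).
Local Notation D := (fs_alg R t).

Definition fs_re : D -> R :=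
  match t return fs_alg R t -> R with
  | FSreal => fun x => x
  | FScomplex => fun x : complex R => complex.Re x
  | FSquaternion => fun x : quaternion R => qre x
  end.

Lemma fs_re_is_zmod_morphism : zmod_morphism fs_re.
Proof. by rewrite /fs_re; case: t => //; case=> ? ? [? ?]. Qed.

HB.instance Definition _ :=
  GRing.isZmodMorphism.Build D R fs_re fs_re_is_zmod_morphism.

Lemma fs_conj_is_zmod_morphism : zmod_morphism (@fs_conj R t).
Proof.
case: t => //= [[a b] [c d]|[a b c d] [a' b' c' d']].
  by apply/eqP; rewrite eq_complex /= !eqxx /= opprD opprK.
by congr Quaternion; rewrite /= opprD.
Qed.

HB.instance Definition _ :=
  GRing.isZmodMorphism.Build D D (@fs_conj R t) fs_conj_is_zmod_morphism.

Lemma fs_real_is_zmod_morphism : zmod_morphism (@fs_real R t).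
Proof.
case: t => //= x y; first by apply/eqP; rewrite eq_complex /= subrr !eqxx.
by congr Quaternion; rewrite /= oppr0 addr0.
Qed.

Lemma fs_real_is_monoid_morphism : monoid_morphism (@fs_real R t).
Proof.
split; first by case: t.
case: t => //= x y.
  by apply/eqP; rewrite eq_complex /=; apply/andP; split; apply/eqP; ring.
by congr Quaternion => /=; ring.
Qed.

HB.instance Definition _ :=
  GRing.isZmodMorphism.Build R D (@fs_real R t) fs_real_is_zmod_morphism.
HB.instance Definition _ :=
  GRing.isMonoidMorphism.Build R D (@fs_real R t) fs_real_is_monoid_morphism.

Implicit Types x y : D.

Lemma fs_conjM x y : fs_conj (x * y) = fs_conj y * fs_conj x.
Proof.
move: x y; case: t => /= [x y|[a b] [c d]|[a b c d] [a' b' c' d']].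
- exact: mulrC.
- by apply/eqP; rewrite eq_complex /=; apply/andP; split; apply/eqP; ring.
- by congr Quaternion => /=; ring.
Qed.

Lemma fs_conjK x : fs_conj (fs_conj x) = x.
Proof. by move: x; case: t => //= [[a b]|[a b c d]]; rewrite /qconj/= !opprK. Qed.

Lemma fs_conj_real (c : R) : fs_conj (fs_real t c) = fs_real t c.
Proof. by case: t => //=; rewrite /qconj /= oppr0. Qed.

Lemma fs_re_real (c : R) : fs_re (fs_real t c) = c.
Proof. by rewrite /fs_re; case: t. Qed.

Lemma fs_re_conj x : fs_re (fs_conj x) = fs_re x.
Proof. by move: x; rewrite /fs_re; case: t => //= [[]]. Qed.

(** Noncommutativity of the quaternions only affects the imaginary part of a product. *)
Lemma fs_reC x y : fs_re (x * y) = fs_re (y * x).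
Proof.
move: x y; rewrite /fs_re.
by case: t => /= [x y|[a b] [c d]|[a b c d] [a' b' c' d']] /=; ring.
Qed.

Lemma fs_realC c x : fs_real t c * x = x * fs_real t c.
Proof.
move: x; case: t => /= [x|[a b]|[a' b' c' d']].
- exact: mulrC.
- by apply/eqP; rewrite eq_complex /=; apply/andP; split; apply/eqP; ring.
- by congr Quaternion => /=; ring.
Qed.

Lemma fs_reZ c x : fs_re (fs_real t c * x) = c * fs_re x.
Proof. by move: x; rewrite /fs_re; case: t => /= [x|[a b]|[a' b' c' d']] /=; ring. Qed.

Lemma fs_coord_dot x y :
  \sum_j fs_coord x 0 j * fs_coord y 0 j = fs_re (fs_conj x * y).
Proof.
move: x y; rewrite /fs_re.
case: t => /= [x y|[a b] [c d]|[a b c d] [a' b' c' d']];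
  rewrite !big_ord_recl big_ord0 !mxE /=; ring.
Qed.

Lemma fs_normsqE x : fs_normsq x = fs_re (fs_conj x * x).
Proof. by rewrite -fs_coord_dot; apply: eq_bigr => j _; rewrite expr2. Qed.

Lemma fs_conj_mul x : fs_conj x * x = fs_real t (fs_normsq x).
Proof.
rewrite fs_normsqE; move: x; rewrite /fs_re; case: t => //= [[a b]|[a b c d]].
- by apply/eqP; rewrite eq_complex /=; apply/andP; split; apply/eqP; ring.
- by congr Quaternion => /=; ring.
Qed.

Lemma fs_coord_inj : injective (@fs_coord R t).
Proof.
case: t => /= [x y|[a b] [c d]|[a b c d] [a' b' c' d']] /rowP e.
- by have := e ord0; rewrite !mxE.
- by have := (e ord0, e ord_max); rewrite !mxE /= => -[-> ->].
- have := (e (inord 0), e (inord 1), e (inord 2), e (inord 3)).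
  by rewrite !mxE !inordK //= => -[[[-> ->] ->] ->].
Qed.

Lemma fs_coord_surj (u : 'rV[R]_(fs_dim t)) : exists x : D, fs_coord x = u.
Proof.
move: u; case: t => /= u.
- by exists (u 0 0); apply/rowP => j; rewrite mxE ord1.
- exists (Complex (u 0 0) (u 0 1)); apply/rowP; case=> [[|[|//]]] i; rewrite mxE /=;
  by congr (u _ _); apply/val_inj.
- exists (Quaternion (u 0 0) (u 0 (inord 1)) (u 0 (inord 2)) (u 0 (inord 3))).
  by apply/rowP; case=> [[|[|[|[|//]]]]] i; rewrite mxE /=;
  congr (u _ _); apply/val_inj; rewrite //= inordK.
Qed.

Lemma fs_normsq_ge0 x : 0 <= fs_normsq x.
Proof. by apply: sumr_ge0 => j _; exact: sqr_ge0. Qed.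

Lemma fs_coord_is_zmod_morphism : zmod_morphism (@fs_coord R t).
Proof.
case: t => /= [x y|[a b] [c d]|[a b c d] [a' b' c' d']]; apply/rowP.
- by move=> j; rewrite !mxE.
- by case=> [[|[|//]]] i; rewrite !mxE.
- by case=> [[|[|[|[|//]]]]] i; rewrite !mxE.
Qed.

HB.instance Definition _ := GRing.isZmodMorphism.Build D ('rV[R]_(fs_dim t))
  (@fs_coord R t) fs_coord_is_zmod_morphism.

Lemma fs_coordZ c x : fs_coord (fs_real t c * x) = c *: fs_coord x.
Proof.
move: x; case: t => /= [x|[a b]|[a' b' c' d']]; apply/rowP.
- by move=> j; rewrite !mxE.
- by case=> [[|[|//]]] i; rewrite !mxE /=; ring.
- by case=> [[|[|[|[|//]]]]] i; rewrite !mxE /=; ring.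
Qed.

Lemma fs_normsq_eq0 x : fs_normsq x = 0 -> x = 0.
Proof.
move=> e; apply: fs_coord_inj; rewrite raddf0; apply/rowP => j.
move/eqP: e; rewrite psumr_eq0; last by move=> *; exact: sqr_ge0.
by move/allP/(_ j (mem_index_enum j)); rewrite sqrf_eq0 => /eqP ->; rewrite mxE.
Qed.

(** Testing against the conjugate of [x] gives its squared norm. An element of D is thus determined
    by the real parts of its multiples, which is how the scalar given by Schur's lemma is
    identified. *)
Lemma fs_re_nondegenerate x : (forall y, fs_re (x * y) = 0) -> x = 0.
Proof.
move=> e; apply: fs_normsq_eq0; rewrite fs_normsqE fs_reC; exact: e.
Qed.

Lemma fs_conj_imaginary x :
  fs_conj (x - fs_real t (fs_re x)) = - (x - fs_real t (fs_re x)).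
Proof.
rewrite opprB raddfB /= fs_conj_real; move: x; rewrite /fs_re.
case: t => /= [x|[a b]|[a b c d]]; first by [].
- by apply/eqP; rewrite eq_complex /=; apply/andP; split; apply/eqP; ring.
- by congr Quaternion => /=; ring.
Qed.

End DivisionAlgebra.

(** * The real inner product on matrices over D *)

Section RealInnerProduct.
Variables (R : realType) (t : fs_type).
Local Notation D := (fs_alg R t).

Lemma adjmxM p q r (A : 'M[D]_(p, q)) (B : 'M[D]_(q, r)) :
  adjmx (A *m B) = adjmx B *m adjmx A.
Proof.
apply/matrixP => i j; rewrite !mxE raddf_sum /=; apply: eq_bigr => k _.
by rewrite !mxE fs_conjM.
Qed.

Lemma adjmxK p q (A : 'M[D]_(p, q)) : adjmx (adjmx A) = A.
Proof. by apply/matrixP => i j; rewrite !mxE fs_conjK. Qed.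

Lemma adjmx_is_zmod_morphism p q : zmod_morphism (@adjmx R t p q).
Proof. by move=> A B; apply/matrixP => i j; rewrite !mxE raddfB. Qed.

HB.instance Definition _ p q := GRing.isZmodMorphism.Build ('M[D]_(p, q))
  ('M[D]_(q, p)) (@adjmx R t p q) (@adjmx_is_zmod_morphism p q).

Lemma adjmx_scale p q c (A : 'M[D]_(p, q)) :
  adjmx (scale_real c A) = scale_real c (adjmx A).
Proof. by apply/matrixP => i j; rewrite !mxE fs_conjM fs_conj_real fs_realC. Qed.

Lemma scale_real_mull p q r c (A : 'M[D]_(p, q)) (B : 'M[D]_(q, r)) :
  scale_real c A *m B = scale_real c (A *m B).
Proof. by rewrite /scale_real scalemxAl. Qed.

Lemma scale_real_mulr p q r c (A : 'M[D]_(p, q)) (B : 'M[D]_(q, r)) :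
  A *m scale_real c B = scale_real c (A *m B).
Proof.
apply/matrixP => i j; rewrite !mxE mulr_sumr; apply: eq_bigr => k _.
by rewrite !mxE !mulrA fs_realC.
Qed.

Lemma scale_realA p q a b (A : 'M[D]_(p, q)) :
  scale_real a (scale_real b A) = scale_real (a * b) A.
Proof. by rewrite /scale_real scalerA rmorphM. Qed.

Lemma scale_real1 p q (A : 'M[D]_(p, q)) : scale_real 1 A = A.
Proof. by rewrite /scale_real rmorph1 scale1r. Qed.

(** The form Re tr(A^* B), which polarizes the squared Frobenius norm; the entrywise shape matches
    the Euclidean dot product under [realvec]. *)
Definition ipmx p q (A B : 'M[D]_(p, q)) : R :=
  \sum_k \sum_l fs_re (fs_conj (A k l) * B k l).

Lemma frobeniusE p q (A : 'M[D]_(p, q)) : frobenius A = Num.sqrt (ipmx A A).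
Proof.
by congr Num.sqrt; apply: eq_bigr => k _; apply: eq_bigr => l _; rewrite fs_normsqE.
Qed.

Lemma ipmx_ge0 p q (A : 'M[D]_(p, q)) : 0 <= ipmx A A.
Proof.
by apply: sumr_ge0 => k _; apply: sumr_ge0 => l _; rewrite -fs_normsqE fs_normsq_ge0.
Qed.

Lemma frobenius_sqr p q (A : 'M[D]_(p, q)) : frobenius A ^+ 2 = ipmx A A.
Proof. by rewrite frobeniusE sqr_sqrtr ?ipmx_ge0. Qed.

Lemma ipmx_eq0 p q (A : 'M[D]_(p, q)) : ipmx A A = 0 -> A = 0.
Proof.
have h k l : 0 <= fs_re (fs_conj (A k l) * A k l) by rewrite -fs_normsqE fs_normsq_ge0.
move/eqP; rewrite psumr_eq0 => [|k _]; last by apply: sumr_ge0.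
move=> /allP e; apply/matrixP => k l; rewrite mxE; apply: fs_normsq_eq0.
have := e k (mem_index_enum k); rewrite /= psumr_eq0 // => /allP.
by move/(_ l (mem_index_enum l)); rewrite /= -fs_normsqE => /eqP.
Qed.

Lemma frobenius1_gt0 p q (A : 'M[D]_(p, q)) : frobenius A = 1 -> (0 < p)%N.
Proof.
case: p A => // A /eqP; rewrite frobeniusE (_ : ipmx A A = 0) ?sqrtr0.
  by rewrite eq_sym oner_eq0.
exact: big_ord0.
Qed.

Lemma ipmx_tr p q (A B : 'M[D]_(p, q)) : ipmx A B = fs_re (\tr (adjmx A *m B)).
Proof.
rewrite /ipmx exchange_big /= raddf_sum; apply: eq_bigr => k _.
by rewrite !mxE raddf_sum; apply: eq_bigr => l _; rewrite !mxE.
Qed.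

Lemma ipmxC p q (A B : 'M[D]_(p, q)) : ipmx A B = ipmx B A.
Proof.
apply: eq_bigr => k _; apply: eq_bigr => l _.
by rewrite -fs_re_conj fs_conjM fs_conjK.
Qed.

Lemma ipmxDr p q (A B C : 'M[D]_(p, q)) : ipmx A (B + C) = ipmx A B + ipmx A C.
Proof. by rewrite !ipmx_tr mulmxDr !raddfD. Qed.

Lemma ipmxBr p q (A B C : 'M[D]_(p, q)) : ipmx A (B - C) = ipmx A B - ipmx A C.
Proof. by rewrite !ipmx_tr mulmxBr !raddfB. Qed.

Lemma ipmx_sumr p q (I : Type) (r : seq I) (P : pred I) A (F : I -> 'M[D]_(p, q)) :
  ipmx A (\sum_(i <- r | P i) F i) = \sum_(i <- r | P i) ipmx A (F i).
Proof.
rewrite ipmx_tr mulmx_sumr (raddf_sum mxtrace) raddf_sum.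
by apply: eq_bigr => i _; rewrite ipmx_tr.
Qed.

Lemma ipmxZr p q c (A B : 'M[D]_(p, q)) : ipmx A (scale_real c B) = c * ipmx A B.
Proof. by rewrite !ipmx_tr scale_real_mulr /scale_real mxtraceZ fs_reZ. Qed.

Lemma ipmxDl p q (A B C : 'M[D]_(p, q)) : ipmx (A + B) C = ipmx A C + ipmx B C.
Proof. by rewrite ipmxC ipmxDr !(ipmxC C). Qed.

Lemma ipmx_mulmxl p q (U : 'M[D]_p) (A B : 'M[D]_(p, q)) :
  adjmx U *m U = 1%:M -> ipmx (U *m A) (U *m B) = ipmx A B.
Proof.
by move=> UU; rewrite !ipmx_tr adjmxM -mulmxA [adjmx U *m (_ *m _)]mulmxA UU mul1mx.
Qed.

Lemma ipmx_nondegenerate p q (A : 'M[D]_(p, q)) :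
  (forall B, ipmx A B = 0) -> A = 0.
Proof. by move=> e; apply: ipmx_eq0. Qed.

Lemma realvec_is_zmod_morphism p q : zmod_morphism (@realvec R t p q).
Proof.
move=> A B; rewrite /realvec -raddfB; congr mxvec; apply/matrixP => i j.
by rewrite raddfB !mxE raddfB !mxE.
Qed.

HB.instance Definition _ p q := GRing.isZmodMorphism.Build ('M[D]_(p, q)) _
  (@realvec R t p q) (@realvec_is_zmod_morphism p q).

Lemma realvecZ p q c (A : 'M[D]_(p, q)) : realvec (scale_real c A) = c *: realvec A.
Proof.
rewrite /realvec -linearZ; congr mxvec; apply/matrixP => i j.
by rewrite !mxE; case/mxvec_indexP: i => k l; rewrite !mxvecE !mxE fs_coordZ !mxE.
Qed.

Lemma realvec_inj p q : injective (@realvec R t p q).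
Proof.
move=> A B /(can_inj mxvecK) /matrixP e; apply/matrixP => k l; apply: fs_coord_inj.
by apply/rowP => j; have := e (mxvec_index k l) j; rewrite !mxE !mxvecE.
Qed.

Lemma realvec_surj p q v : exists A : 'M[D]_(p, q), realvec A = v.
Proof.
pose f k := projT1 (cid (fs_coord_surj (t := t) (row k (vec_mx v)))).
exists (vec_mx (\row_k f k)); rewrite /realvec vec_mxK.
apply: (canLR vec_mxK); apply/matrixP => k j; rewrite !mxE /f; case: cid => x /= ->.
by rewrite !mxE.
Qed.

Lemma sum_mxvec_index (V : nmodType) p q (F : 'I_(p * q) -> V) :
  \sum_i F i = \sum_k \sum_l F (mxvec_index k l).
Proof.
rewrite (reindex _ (curry_mxvec_bij p q)) /= pair_bigA /=.
by apply: eq_bigr => -[k l] _.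
Qed.

(** This isometry allows moments of orbits to be computed with matrices over D rather than in real
    coordinates. *)
Lemma dotv_realvec p q (A B : 'M[D]_(p, q)) :
  dotv (realvec A) (realvec B) = ipmx A B.
Proof.
rewrite /dotv !sum_mxvec_index; apply: eq_bigr => k _; apply: eq_bigr => l _.
rewrite -fs_coord_dot.
by apply: eq_bigr => j _; rewrite !mxvecE !mxE !mxvecE.
Qed.

End RealInnerProduct.

(** * Measurability and integration on the sphere of a subspace *)

Section SphereIntegral.
Variables (R : realType) (N : nat).
Local Notation V := 'rV[R]_N.
Local Notation B := (borel_rV R N).

Lemma dotvC (x y : V) : dotv x y = dotv y x.
Proof. by apply: eq_bigr => i _; rewrite mulrC. Qed.

Lemma dotv_mx (x y : V) : dotv x y = (x *m y^T) 0 0.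
Proof. by rewrite mxE; apply: eq_bigr => i _; rewrite mxE. Qed.

Lemma dotvDl (x y z : V) : dotv (x + y) z = dotv x z + dotv y z.
Proof. by rewrite !dotv_mx mulmxDl mxE. Qed.

Lemma dotvDr (x y z : V) : dotv x (y + z) = dotv x y + dotv x z.
Proof. by rewrite dotvC dotvDl !(dotvC x). Qed.

Lemma dotvZl c (x y : V) : dotv (c *: x) y = c * dotv x y.
Proof. by rewrite !dotv_mx -scalemxAl mxE. Qed.

Lemma dotvZr c (x y : V) : dotv x (c *: y) = c * dotv x y.
Proof. by rewrite dotvC dotvZl dotvC. Qed.

Lemma dotvNr (x y : V) : dotv x (- y) = - dotv x y.
Proof. by rewrite -scaleN1r dotvZr mulN1r. Qed.

Lemma dotvNl (x y : V) : dotv (- x) y = - dotv x y.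
Proof. by rewrite dotvC dotvNr dotvC. Qed.

Lemma dotv0 (x : V) : dotv x 0 = 0.
Proof. by rewrite -(scale0r 0) dotvZr mul0r. Qed.

Lemma dotv_ge0 (x : V) : 0 <= dotv x x.
Proof. by apply: sumr_ge0 => i _; rewrite -expr2 sqr_ge0. Qed.

Lemma dotv_eq0 (x : V) : (dotv x x == 0) = (x == 0).
Proof.
apply/idP/eqP => [|->]; last by rewrite dotv0.
rewrite psumr_eq0; last by move=> i _; rewrite -expr2 sqr_ge0.
move/allP => e; apply/rowP => i; rewrite mxE; apply/eqP.
by have := e i (mem_index_enum i); rewrite /= mulf_eq0 orbb.
Qed.

Lemma dotv_delta (x : V) i : dotv x (delta_mx 0 i) = x 0 i.
Proof.
rewrite /dotv (bigD1 i) //= big1 ?addr0 ?mxE ?eqxx ?mulr1 // => j ji.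
by rewrite mxE eqxx (negbTE ji) mulr0.
Qed.

Lemma measurable_continuous_rV (f : V -> R) :
  continuous f -> measurable_fun (setT : set B) (f : B -> R).
Proof.
move=> /continuousP cf; apply: (measurability _ (RGenOpens.measurableE R)).
move=> _ [_ [a [b ->] <-]]; rewrite setTI; apply: sub_sigma_algebra.
exact/cf/interval_open.
Qed.

Lemma measurable_coord i : measurable_fun (setT : set B) (fun x : B => x 0 i : R).
Proof. by apply: measurable_continuous_rV; exact: coord_continuous. Qed.

Lemma measurable_dotv w : measurable_fun (setT : set B) (fun x : B => dotv x w : R).
Proof.
apply: measurable_sum => i; apply: measurable_funM; last exact: measurable_cst.
exact: measurable_coord.
Qed.

Lemma measurable_mulmxr (A : 'M[R]_N) :
  measurable_fun (setT : set B) (fun x : B => (x : V) *m A : B).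
Proof.
have defB : @measurable _ B = <<s @open V >> by [].
apply: (measurability _ defB) => _ [U oU <-]; rewrite setTI.
apply: sub_sigma_algebra.
have cA : continuous (fun x : V => x *m A).
  have -> : (fun x : V => x *m A) = (fun x => \sum_i x 0 i *: row i A).
    by apply/funext => x; rewrite mulmx_sum_row.
  apply: continuous_big => [|i _]; first exact: add_continuous.
  move=> x; apply: cvgZr_tmp; [exact: (@nbhs_filter _ x)|exact: coord_continuous].
by move/continuousP: cA; apply.
Qed.

Variable E : {vspace V}.
Local Notation S := (unit_sphere E).

(** A point lies in [E] exactly when [projv E] fixes it, so the sphere is an intersection of level
    sets of two measurable functions. *)
Lemma measurable_unit_sphere : measurable (S : set B).
Proof.
(* [f] is the squared length of x - [projv E x], written with dot products so that its measurability
   is immediate. *)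
pose f (x : B) := \sum_i (dotv (x : V) (delta_mx 0 i) -
   dotv (x : V) (\row_j (projv E (delta_mx 0 j : V)) 0 i)) ^+ 2.
pose g (x : B) := dotv (x : V) x.
have projE (x : V) i : projv E x 0 i = dotv x (\row_j (projv E (delta_mx 0 j : V)) 0 i).
  rewrite {1}[x]row_sum_delta linear_sum summxE; apply: eq_bigr => j _.
  by rewrite linearZ !mxE.
have SE : S = (f @^-1` [set 0]) `&` (g @^-1` [set 1]).
  apply/seteqP; split=> x [/= xE xx]; split=> //.
    by rewrite /f /= big1 // => i _; rewrite -projE projv_id // dotv_delta subrr expr0n.
  move/eqP: xE; rewrite psumr_eq0 => [/allP xE|*]; last exact: sqr_ge0.
  suff -> : x = projv E x by rewrite memv_proj.
  apply/rowP => i; have := xE i (mem_index_enum i).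
  by rewrite /= sqrf_eq0 subr_eq0 -projE dotv_delta => /eqP.
rewrite SE; apply: measurableI.
- rewrite -[X in measurable X]setTI.
  have mf : measurable_fun (setT : set B) f.
    apply: measurable_sum => i; apply: measurable_funX.
    by apply: measurable_funB; exact: measurable_dotv.
  by apply: mf => //; exact: measurable_set1.
- rewrite -[X in measurable X]setTI.
  have mg : measurable_fun (setT : set B) g.
    by apply: measurable_sum => i; apply: measurable_funM; exact: measurable_coord.
  by apply: mg => //; exact: measurable_set1.
Qed.

(** This class is contained in the integrable functions for every probability measure and, unlike
    integrability, is stable under products. *)
Definition sphere_bounded (f : V -> R) : Prop :=
  measurable_fun (setT : set B) (f : B -> R) /\
  exists C, forall x, S x -> `|f x| <= C.

Lemma sphere_bounded_cst c : sphere_bounded (fun=> c).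
Proof. by split; [exact: measurable_cst|exists `|c|]. Qed.

Lemma sphere_bounded_coord i : sphere_bounded (fun x => x 0 i).
Proof.
split; first exact: measurable_coord.
exists 1 => x [_ xx]; rewrite -(@ler_pXn2r _ 2) ?nnegrE // expr1n -xx.
rewrite real_normK ?num_real // /dotv (bigD1 i) //= -expr2 lerDl.
by apply: sumr_ge0 => j _; rewrite -expr2 sqr_ge0.
Qed.

Lemma sphere_boundedD f g :
  sphere_bounded f -> sphere_bounded g -> sphere_bounded (fun x => f x + g x).
Proof.
move=> [mf [C bf]] [mg [C' bg]]; split; first exact: measurable_funD.
exists (C + C') => x Sx; apply: le_trans (ler_normD _ _) _.
by apply: lerD; [exact: bf|exact: bg].
Qed.

Lemma sphere_boundedM f g :
  sphere_bounded f -> sphere_bounded g -> sphere_bounded (fun x => f x * g x).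
Proof.
move=> [mf [C bf]] [mg [C' bg]]; split; first exact: measurable_funM.
by exists (C * C') => x Sx; rewrite normrM; apply: ler_pM; rewrite ?bf ?bg.
Qed.

Lemma sphere_bounded_sum I (r : seq I) (f : I -> V -> R) :
  (forall i, sphere_bounded (f i)) -> sphere_bounded (fun x => \sum_(i <- r) f i x).
Proof.
move=> bf; elim: r => [|i r IH].
  by under eq_fun do rewrite big_nil; exact: sphere_bounded_cst.
by under eq_fun do rewrite big_cons; exact: sphere_boundedD.
Qed.

Lemma sphere_bounded_dotv w : sphere_bounded (fun x => dotv x w).
Proof.
apply: sphere_bounded_sum => i; apply: sphere_boundedM (sphere_bounded_cst _).
exact: sphere_bounded_coord.
Qed.

Variable mu : probability B R.

Definition sphere_mean (f : V -> R) : R := Rintegral mu (S : set B) (f : B -> R).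

Lemma sphere_bounded_integrable f :
  sphere_bounded f -> mu.-integrable (S : set B) (EFin \o (f : B -> R)).
Proof.
move=> [mf [C bf]]; apply: measurable_bounded_integrable.
- exact: measurable_unit_sphere.
- by apply: le_lt_trans (probability_le1 _ _) _; [exact: measurable_unit_sphere|exact: ltry].
- exact: measurable_funTS.
- by exists C; split; [exact: num_real|move=> D CD x Sx; exact: le_trans (bf _ Sx) (ltW CD)].
Qed.

Lemma integral_sphere_mean f : sphere_bounded f ->
  (\int[mu]_(x in (S : set B)) (f x)%:E)%E = (sphere_mean f)%:E.
Proof.
move=> bf; rewrite /sphere_mean /Rintegral fineK //.
apply: integrable_fin_num; first exact: measurable_unit_sphere.
exact: sphere_bounded_integrable.
Qed.

Lemma sphere_mean0 : sphere_mean (fun=> 0) = 0.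
Proof. by rewrite /sphere_mean Rintegral_cst ?mul0r //; exact: measurable_unit_sphere. Qed.

Lemma sphere_meanZ c f : sphere_bounded f ->
  sphere_mean (fun x => c * f x) = c * sphere_mean f.
Proof.
move=> bf; apply: RintegralZl; first exact: measurable_unit_sphere.
exact: sphere_bounded_integrable.
Qed.

Lemma sphere_meanD f g : sphere_bounded f -> sphere_bounded g ->
  sphere_mean (fun x => f x + g x) = sphere_mean f + sphere_mean g.
Proof.
move=> bf bg; apply: RintegralD; first exact: measurable_unit_sphere.
  exact: sphere_bounded_integrable.
exact: sphere_bounded_integrable.
Qed.

Lemma sphere_mean_sum I (r : seq I) (f : I -> V -> R) :
  (forall i, sphere_bounded (f i)) ->
  sphere_mean (fun x => \sum_(i <- r) f i x) = \sum_(i <- r) sphere_mean (f i).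
Proof.
move=> bf; elim: r => [|i r IH].
  by under eq_fun do rewrite big_nil; rewrite big_nil sphere_mean0.
rewrite big_cons -IH; under eq_fun do rewrite big_cons.
by apply: sphere_meanD => //; exact: sphere_bounded_sum.
Qed.

Hypothesis mu_unif : uniform_on_sphere E mu.

Lemma sphere_mean1 : sphere_mean (fun=> 1) = 1.
Proof.
rewrite /sphere_mean Rintegral_cst; last exact: measurable_unit_sphere.
by case: mu_unif => muS _; rewrite mul1r (_ : _ S = 1%E).
Qed.

(** Change of variables along the pushforward of [mu]. With membership in [E] preserved in both
    directions, the preimage of the sphere is the sphere itself, so the domain of integration does
    not move. *)
Lemma sphere_mean_mulmxr (A : 'M[R]_N) f : sphere_bounded f ->
  (forall x, (x *m A \in E) = (x \in E)) ->
  (forall x, dotv (x *m A) (x *m A) = dotv x x) ->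
  sphere_mean (fun x => f (x *m A)) = sphere_mean f.
Proof.
move=> bf AE Adot; pose phi (x : B) : B := (x : V) *m A.
have preS : phi @^-1` S = S.
  by apply/seteqP; split=> x [/=]; rewrite ?AE ?Adot => ? ?; split=> //=; rewrite ?AE ?Adot.
have mphi : measurable_fun (setT : set B) phi by exact: measurable_mulmxr.
have mS := measurable_unit_sphere.
have bfA : sphere_bounded (fun x => f (x *m A)).
  split; first exact: measurableT_comp bf.1 mphi.
  case: bf => _ [C bf]; exists C => x Sx; apply: bf.
  by rewrite -preS in Sx.
congr fine.
transitivity (\int[pushforward mu phi]_(y in (S : set B)) (f y)%:E)%E.
  rewrite (integral_pushforward mphi) ?preS //.
  - by apply/measurable_EFinP; case: bf.
  - exact: (sphere_bounded_integrable bfA).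
apply: eq_measure_integral => X mX _; case: mu_unif => _ /(_ A); apply => //.
by move=> x xE; rewrite AE Adot.
Qed.

End SphereIntegral.

(** * First and second moments of the sphere *)

Section SphereMoments.
Variables (R : realType) (N : nat).
Local Notation V := 'rV[R]_N.
Variables (E : {vspace V}) (mu : probability (borel_rV R N) R).
Hypothesis mu_unif : uniform_on_sphere E mu.
Local Notation mean := (sphere_mean E mu).

(** The antipodal map preserves the sphere and negates the integrand. *)
Lemma sphere_mean_dotv w : mean (fun x => dotv x w) = 0.
Proof.
have bw := sphere_bounded_dotv E w.
have e : mean (fun x => dotv (x *m (-1)%:M) w) = mean (fun x => dotv x w).
  apply: (sphere_mean_mulmxr mu_unif bw) => x; rewrite mul_mx_scalar scaleN1r.
    exact: memvN.
  by rewrite dotvNl dotvNr opprK.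
have {}e : - mean (fun x => dotv x w) = mean (fun x => dotv x w).
  rewrite -[RHS]e -(mulN1r (mean _)) -sphere_meanZ //; congr sphere_mean; apply/funext => x.
  by rewrite mul_mx_scalar dotvZl.
by apply/eqP; rewrite -[_ == _](mulrn_eq0 _ 2) mulr2n -{1}e addNr.
Qed.

Lemma sphere_bounded_dotv2 u w : sphere_bounded E (fun x => dotv x u * dotv x w).
Proof. by apply: sphere_boundedM; exact: sphere_bounded_dotv. Qed.

(* The reflection along v - w exchanges the unit vectors v and w. *)
Lemma sphere_mean_sqr_unit v w : v \in E -> w \in E -> dotv v v = dotv w w ->
  mean (fun x => dotv x v * dotv x v) = mean (fun x => dotv x w * dotv x w).
Proof.
move=> vE wE vw; have [->//|neq] := eqVneq v w.
have [u [uE uu u_def]] : exists u, [/\ u \in E, dotv u u != 0 & u = v - w].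
  by exists (v - w); rewrite memvB // dotv_eq0 subr_eq0.
pose k := 2 / dotv u u; pose A := 1%:M - k *: (u^T *m u).
have AE (x : V) : x *m A = x - (k * dotv x u) *: u.
  rewrite mulmxBr mulmx1 -scalemxAr mulmxA [x *m u^T]mx11_scalar mul_scalar_mx -dotv_mx.
  by rewrite scalerA.
have AA (x : V) : x *m A *m A = x.
  rewrite !AE dotvDl dotvNl dotvZl.
  have -> : k * (dotv x u - k * dotv x u * dotv u u) = - (k * dotv x u) by rewrite /k; field.
  by rewrite scaleNr opprK subrK.
have Adot (x y : V) : dotv (x *m A) y = dotv x (y *m A).
  by rewrite !AE !dotvDl !dotvDr dotvNl dotvNr dotvZl dotvZr (dotvC u); ring.
have vA : w *m A = v.
  (* Since v and w have equal length and u = v - w, <u, u> = -2 <w, u>. *)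
  rewrite AE /k; have -> : 2 / dotv u u * dotv w u = -1.
    apply: (mulIf uu); rewrite mulrAC divfK // u_def.
    by rewrite !dotvDl !dotvDr !dotvNl !dotvNr vw (dotvC v w); ring.
  by rewrite scaleN1r opprK u_def addrC subrK.
rewrite -(sphere_mean_mulmxr mu_unif (sphere_bounded_dotv2 v v) (A := A)).
- by congr sphere_mean; apply/funext => x; rewrite !Adot -vA AA.
- have sub (x : V) : x \in E -> x *m A \in E by move=> xE; rewrite AE memvB // memvZ.
  by move=> x; apply/idP/idP => [/sub|/sub //]; rewrite AA.
- by move=> x; rewrite Adot AA.
Qed.

(** By homogeneity, a nonzero w can be rescaled to the length of one fixed reference vector, with
    which [sphere_mean_sqr_unit] compares it. *)
Lemma sphere_mean_sqr : exists c, forall w, w \in E ->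
  mean (fun x => dotv x w * dotv x w) = c * dotv w w.
Proof.
(* [vpick E] vanishes only for E = 0; then every w is 0 and the value of the constant, a division by
   0, is harmless. *)
pose v := vpick E; have vE : v \in E := memv_pick E.
exists (mean (fun x => dotv x v * dotv x v) / dotv v v) => w wE.
have [w0|w0] := eqVneq w 0.
  rewrite w0 dotv0 mulr0 -(sphere_mean0 E mu).
  by congr sphere_mean; apply/funext => x; rewrite dotv0 !mul0r.
have v0 : dotv v v != 0.
  rewrite dotv_eq0 vpick0; apply: contra w0 => /eqP E0.
  by rewrite E0 memv0 in wE.
have w0' : dotv w w != 0 by rewrite dotv_eq0.
pose s := Num.sqrt (dotv v v / dotv w w).
have ss : s * s = dotv v v / dotv w w by rewrite -expr2 sqr_sqrtr // divr_ge0 ?dotv_ge0.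
rewrite (@sphere_mean_sqr_unit v (s *: w)) ?memvZ //; last first.
  by rewrite dotvZl dotvZr mulrA ss divfK.
have -> : (fun x => dotv x (s *: w) * dotv x (s *: w)) =
          (fun x => (dotv v v / dotv w w) * (dotv x w * dotv x w)).
  by apply/funext => x; rewrite !dotvZr -ss; ring.
rewrite sphere_meanZ; last exact: sphere_bounded_dotv2.
by field; rewrite v0.
Qed.

(** Polarization of [sphere_mean_sqr]. *)
Lemma sphere_mean_dotv2 : exists c, forall u w, u \in E -> w \in E ->
  mean (fun x => dotv x u * dotv x w) = c * dotv u w.
Proof.
have [c H] := sphere_mean_sqr; exists c => u w uE wE.
have := H _ (memvD uE wE).
have -> : (fun x => dotv x (u + w) * dotv x (u + w)) =
    (fun x => dotv x u * dotv x u + dotv x w * dotv x w + 2 * (dotv x u * dotv x w)).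
  by apply/funext => x; rewrite !dotvDr; ring.
have b2 := sphere_bounded_dotv2.
have bD := sphere_boundedD (b2 u u) (b2 w w).
have bM := sphere_boundedM (sphere_bounded_cst E 2) (b2 u w).
rewrite !sphere_meanD ?sphere_meanZ //.
rewrite !H // !dotvDl !dotvDr (dotvC w u) => e.
have {}e : 2 * mean (fun x => dotv x u * dotv x w) = 2 * (c * dotv u w).
  by apply: (addrI (c * dotv u u + c * dotv w w)); rewrite e; ring.
by apply: (mulfI (_ : 2 != 0 :> R)) e; rewrite pnatr_eq0.
Qed.

End SphereMoments.

(** * Reduction of the 2-design property to moments of degree at most 2 *)

Section TwoDesigns.
Variables (R : realType) (N : nat).
Local Notation V := 'rV[R]_N.

Definition set_mean (X : set V) (f : V -> R) : R :=
  (#|` fset_set X|%:R)^-1 * \sum_(x \in X) f x.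

Lemma set_mean_sum (X : set V) I (r : seq I) (c : I -> R) (f : I -> V -> R) :
  finite_set X ->
  set_mean X (fun x => \sum_(i <- r) c i * f i x) = \sum_(i <- r) c i * set_mean X (f i).
Proof.
move=> finX; rewrite /set_mean fsbig_finite // exchange_big /= mulr_sumr.
by apply: eq_bigr => i _; rewrite fsbig_finite // -mulr_sumr mulrCA.
Qed.

(** A variable with positive exponent can be peeled off; two applications list all monomials of
    degree at most 2. *)
Lemma monomial_split (a : 'I_N -> nat) k : (\sum_i a i)%N = k.+1 ->
  exists i, exists2 b : 'I_N -> nat, (\sum_i b i)%N = k &
    forall x : V, \prod_j x 0 j ^+ a j = x 0 i * \prod_j x 0 j ^+ b j.
Proof.
move=> ak; have [i ai] : exists i, (0 < a i)%N.
  apply/existsP; apply: contra_eqT ak => /existsPn a0.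
  by rewrite big1 // => i _; apply/eqP; rewrite -leqn0 leqNgt a0.
exists i; exists (fun j => (a j - (j == i))%N) => [|x].
  apply: succn_inj; rewrite -ak (bigD1 i) //= [in RHS](bigD1 i) //=.
  rewrite eqxx -addSn subn1 prednK //.
  by congr addn; apply: eq_bigr => j /negbTE ->; rewrite subn0.
rewrite (bigD1 i) //= [in RHS](bigD1 i) //= eqxx mulrA -exprS subn1 prednK //.
by congr (_ * _); apply: eq_bigr => j /negbTE ->; rewrite subn0.
Qed.

Lemma monomial0 (a : 'I_N -> nat) : (\sum_i a i)%N = 0 ->
  forall x : V, \prod_j x 0 j ^+ a j = 1.
Proof.
move=> a0 x; apply: big1 => j _; move/eqP: a0; rewrite sum_nat_eq0 => /forallP/(_ j).
by move=> /eqP ->.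
Qed.

Variables (E : {vspace V}) (mu : probability (borel_rV R N) R).
Hypothesis mu_unif : uniform_on_sphere E mu.
Local Notation mean := (sphere_mean E mu).

(** The design property is applied to the monomials x_i x_j and extended to products of linear forms
    by bilinearity. *)
Lemma spherical_design_moment2 X u w : spherical_design E mu 2 X ->
  set_mean X (fun x => dotv x u * dotv x w) = mean (fun x => dotv x u * dotv x w).
Proof.
case=> finX _ _ Xd.
have bx i j : sphere_bounded E (fun x => x 0 i * x 0 j).
  exact: sphere_boundedM (sphere_bounded_coord _ _) (sphere_bounded_coord _ _).
have mij i j : set_mean X (fun x => x 0 i * x 0 j) = mean (fun x => x 0 i * x 0 j).
  have /= := Xd (mpoly.mpolyX R (mpoly.mnm_add (mpoly.mnm1 i) (mpoly.mnm1 j))).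
  rewrite mpoly.msuppX /= mpoly.mdegD !mpoly.mdeg1 => /(_ isT).
  under eq_fsbigr do rewrite mpoly.mpolyXD mpoly.mevalM !mpoly.mevalXU.
  under eq_integral do rewrite mpoly.mpolyXD mpoly.mevalM !mpoly.mevalXU.
  by rewrite integral_sphere_mean // => -[].
have -> : (fun x => dotv x u * dotv x w) =
    (fun x => \sum_(p <- enum {: 'I_N * 'I_N}) (u 0 p.1 * w 0 p.2) * (x 0 p.1 * x 0 p.2)).
  apply/funext => x; rewrite big_enum /=.
  rewrite -(pair_bigA _ (fun i j => (u 0 i * w 0 j) * (x 0 i * x 0 j))) /=.
  rewrite mulr_suml; apply: eq_bigr => i _; rewrite mulr_sumr; apply: eq_bigr => j _; ring.
rewrite set_mean_sum // sphere_mean_sum => [|p]; last first.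
  exact: sphere_boundedM (sphere_bounded_cst _ _) (bx _ _).
by apply: eq_bigr => p _; rewrite mij sphere_meanZ.
Qed.

(** Degree at most 2 leaves the monomials 1, x_i and x_i x_j. The constants agree because X is
    nonempty and [mu] gives the sphere mass 1. *)
Lemma spherical_design2 X : finite_set X -> X !=set0 -> X `<=` unit_sphere E ->
  (forall i, set_mean X (fun x => x 0 i) = mean (fun x => x 0 i)) ->
  (forall i j, set_mean X (fun x => x 0 i * x 0 j) = mean (fun x => x 0 i * x 0 j)) ->
  spherical_design E mu 2 X.
Proof.
move=> finX X0 XS X1 X2; split=> // p; set A := mpoly.msupp p => pA f.
have bx i : sphere_bounded E (fun x => x 0 i) by exact: sphere_bounded_coord.
have bxx i j : sphere_bounded E (fun x => x 0 i * x 0 j) by exact: sphere_boundedM.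
have X00 : set_mean X (fun=> 1) = mean (fun=> 1).
  rewrite (sphere_mean1 mu_unif) /set_mean fsbig_finite // big_const_seq count_predT.
  rewrite -[X in _ * iter X _ _]/(#|` fset_set X|) iter_addr_0 mulVf // pnatr_eq0.
  by rewrite cardfs_eq0; apply: contraPneq X0 => /(fset_set_set0 finX) ->; case=> ?.
pose mon (a : mpoly.multinom N) (x : V) := \prod_i x 0 i ^+ mpoly.fun_of_multinom a i.
have monP a (da : (mpoly.mdeg a <= 2)%N) :
    sphere_bounded E (mon a) /\ set_mean X (mon a) = mean (mon a).
  suff : [\/ mon a = (fun=> 1), exists i, mon a = (fun x => x 0 i) |
             exists i j, mon a = (fun x => x 0 i * x 0 j)].
    by case=> [->|[i ->]|[i [j ->]]]; split=> //; exact: sphere_bounded_cst.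
  rewrite mpoly.mdegE in da.
  case ak: (\sum_i mpoly.fun_of_multinom a i)%N da => [|k] da.
    by apply: Or31; apply/funext; exact: monomial0.
  have [i [b bk bE]] := monomial_split ak; case: k bk {ak} da => [|k] bk da.
    by apply: Or32; exists i; apply/funext => x; rewrite /mon bE (monomial0 bk) mulr1.
  have [j [c ck cE]] := monomial_split bk; case: k ck {bk} da => // ck _.
  apply: Or33; exists i, j; apply/funext => x.
  by rewrite /mon bE cE (monomial0 ck) mulr1.
(* The cut-off makes boundedness available at every index without a degree condition; it changes no
   term of [p], whose support has degree at most 2. *)
pose mon' a := if (mpoly.mdeg a <= 2)%N then mon a else fun=> 0.
have bmon a : sphere_bounded E (mon' a).
  by rewrite /mon'; case: ifP => [/monP[]//|_]; exact: sphere_bounded_cst.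
have fE : f = (fun x => \sum_(a <- A) mpoly.mcoeff a p * mon' a x).
  apply/funext => x; rewrite /f mpoly.mevalE -/A; elim: A pA => [|a s IH] /=.
    by rewrite !big_nil.
  by case/andP=> da /IH; rewrite !big_cons /mon' da => ->.
have bc a : sphere_bounded E (fun x => mpoly.mcoeff a p * mon' a x).
  exact: sphere_boundedM (sphere_bounded_cst _ _) _.
rewrite -[X in X%:E]/(set_mean X f) integral_sphere_mean; last first.
  by rewrite fE; exact: sphere_bounded_sum.
congr _%:E; rewrite fE set_mean_sum // sphere_mean_sum //; apply: eq_bigr => a _.
rewrite sphere_meanZ // /mon'; case: ifP => [/monP[_ ->] //|_]; congr (_ * _).
by rewrite sphere_mean0 /set_mean fsbig1 ?mulr0.
Qed.

End TwoDesigns.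

(** All fibres over the image have the same size k, so counting with multiplicity multiplies both
    the sum and the cardinal by k. *)
Lemma set_mean_image (R : realType) (N : nat) (I : finType) (A : {set I})
    (phi : I -> 'rV[R]_N) (k : nat) (f : 'rV[R]_N -> R) :
  (0 < #|A|)%N -> (forall a, a \in A -> #|[set b in A | phi b == phi a]| = k) ->
  set_mean (phi @` [set` A]) f = #|A|%:R^-1 * \sum_(a in A) f (phi a).
Proof.
move=> A0 phik; pose s := [seq phi a | a <- enum A]; pose r := undup s.
have XE : phi @` [set` A] = [set` r].
  apply/seteqP; split=> x /=.
    by case=> a aA <-; rewrite mem_undup; apply: map_f; rewrite mem_enum.
  by rewrite mem_undup => /mapP[a]; rewrite mem_enum => aA ->; exists a.
have count_s x : x \in r -> count_mem x s = k.
  rewrite mem_undup => /mapP[a]; rewrite mem_enum => aA ->.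
  rewrite count_map -sum1_count big_enum_cond -(phik a aA) -sum1_card.
  by apply: eq_bigl => b; rewrite inE.
have sumE (g : 'rV[R]_N -> R) : \sum_(a in A) g (phi a) = k%:R * \sum_(x <- r) g x.
  rewrite -big_enum -(big_map phi xpredT g) -/s -big_undup_iterop_count.
  rewrite mulr_sumr; apply: eq_big_seq => x xr; rewrite count_s //.
  exact/esym/mulr_natl.
have finX : finite_set [set` r] by exact: finite_seq.
rewrite XE /set_mean -fsbig_seq ?undup_uniq // sumE.
have cardX : #|` fset_set [set` r]|%:R = \sum_(x <- r) 1 :> R.
  by rewrite fsbig_seq ?undup_uniq // fsbig_finite // big_const_seq count_predT iter_addr_0.
(* Summing the constant 1 gives |A| = k |r|, and |A| > 0 makes both factors nonzero. *)
rewrite cardX; have := sumE (fun=> 1); rewrite sumr_const => cardA.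
have : #|A|%:R != 0 :> R by rewrite pnatr_eq0 -lt0n.
by rewrite cardA mulf_eq0 negb_or => /andP[k0 r0]; field; rewrite k0 r0.
Qed.

(** * Moments of orbits in V and in matrices over D, through Schur's lemma *)

Section HermitianRepresentation.
Variables (R : realType) (gT : finGroupType) (G : {group gT}).
Variables (t : fs_type) (N n : nat) (rG : mx_representation R G N).
Local Notation D := (fs_alg R t).
Local Notation V := 'rV[R]_N.
Variables (delta : D -> 'M[R]_N) (h : V -> V -> D) (e : 'I_n -> V).
Hypothesis delta_iso : fs_iso rG delta.
Hypothesis h_herm : invariant_hermitian rG delta h.
Local Notation lact := (lact rG).
Local Notation rho := (Dmatrix rG h e).

Lemma herm_zmod_morphism u : zmod_morphism (h u).
Proof.
case: h_herm => hD _ _ _ _ v w.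
by apply: (addIr (h u w)); rewrite subrK -hD subrK.
Qed.

HB.instance Definition _ u :=
  GRing.isZmodMorphism.Build V D (h u) (herm_zmod_morphism u).

Lemma herm_delta u v x : h u (v *m delta x) = h u v * x.
Proof. by case: h_herm. Qed.

Lemma herm_conj u v : h v u = fs_conj (h u v).
Proof. by case: h_herm. Qed.

Lemma herm_deltal u v x : h (u *m delta x) v = fs_conj x * h u v.
Proof. by rewrite herm_conj herm_delta fs_conjM -herm_conj. Qed.

Lemma herm_lact g u v : g \in G -> h (lact g u) (lact g v) = h u v.
Proof. by case: h_herm => _ _ _ _ + gG; exact. Qed.

Lemma delta_zmod_morphism : zmod_morphism delta.
Proof.
case: delta_iso => dD _ _ _ _ x y.
by apply: (addIr (delta y)); rewrite subrK -dD subrK.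
Qed.

HB.instance Definition _ :=
  GRing.isZmodMorphism.Build D ('M[R]_N) delta delta_zmod_morphism.

Lemma deltaM x y : delta (x * y) = delta x *m delta y.
Proof. by case: delta_iso. Qed.

Lemma delta_real c : delta (fs_real t c) = c%:M.
Proof. by case: delta_iso. Qed.

Lemma hermZr c u v : h u (c *: v) = fs_real t c * h u v.
Proof. by rewrite -mul_mx_scalar -delta_real herm_delta fs_realC. Qed.

Lemma lactM g k v : g \in G -> k \in G -> lact (g * k)%g v = lact g (lact k v).
Proof. by move=> gG kG; rewrite /Defs.lact invMg repr_mxM ?groupV // mulmxA. Qed.

Lemma lact1 v : lact 1%g v = v.
Proof. by rewrite /Defs.lact invg1 repr_mx1 mulmx1. Qed.

Lemma lact_delta g v x : g \in G -> lact g (v *m delta x) = lact g v *m delta x.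
Proof.
move=> gG; rewrite /Defs.lact -!mulmxA.
have /centgmxP -> // : centgmx rG (delta x); last by rewrite groupV.
by case: delta_iso => _ _ _ _ H; apply/H; exists x.
Qed.

Lemma lact_sum I (r : seq I) (P : pred I) g (F : I -> V) :
  lact g (\sum_(i <- r | P i) F i) = \sum_(i <- r | P i) lact g (F i).
Proof. by rewrite /Defs.lact mulmx_suml. Qed.

Definition herm_re u v : R := fs_re (h u v).

Lemma herm_reC u v : herm_re u v = herm_re v u.
Proof. by rewrite /herm_re herm_conj fs_re_conj. Qed.

(** The Gram matrix of Re h in the standard real basis, which need not be orthonormal for it. *)
Definition herm_gram : 'M[R]_N :=
  \matrix_(i, j) herm_re (delta_mx 0 i) (delta_mx 0 j).

Lemma herm_reZr c u v : herm_re u (c *: v) = c * herm_re u v.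
Proof. by rewrite /herm_re hermZr fs_reZ. Qed.

Lemma herm_re_sumr I (r : seq I) u (F : I -> V) :
  herm_re u (\sum_(i <- r) F i) = \sum_(i <- r) herm_re u (F i).
Proof. by rewrite /herm_re !raddf_sum /=. Qed.

Lemma herm_reE u v : herm_re u v = (u *m herm_gram *m v^T) 0 0.
Proof.
rewrite {1}[v]row_sum_delta herm_re_sumr mxE; apply: eq_bigr => j _.
rewrite herm_reZr mxE mulrC; congr (_ * _); last by rewrite mxE.
rewrite herm_reC {1}[u]row_sum_delta herm_re_sumr; apply: eq_bigr => i _.
by rewrite herm_reZr mxE herm_reC.
Qed.

(** By positive definiteness: a vector u in the kernel has Re h(u, u) = 0. *)
Lemma herm_gram_unit : herm_gram \in unitmx.
Proof.
rewrite -row_free_unit -kermx_eq0; apply/eqP/row_matrixP => i; rewrite row0.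
set u := row i _; have uH : u *m herm_gram = 0 by rewrite -row_mul mulmx_ker row0.
have [//|u0] := eqVneq u 0.
case: h_herm => _ _ _ /(_ u u0)[c c0 huu] _.
have : herm_re u u = 0 by rewrite herm_reE uH mul0mx mxE.
by rewrite /herm_re huu fs_re_real => c00; rewrite c00 ltxx in c0.
Qed.

(* An imaginary scalar acts by an operator that is skew-adjoint for herm_re, hence
   has trace 0. *)
Lemma mxtrace_delta x : \tr (delta x) = N%:R * fs_re x.
Proof.
pose y := x - fs_real t (fs_re x).
have skew : delta y *m herm_gram = - (herm_gram *m (delta y)^T).
  apply/matrixP => i j.
  have ent (C : 'M[R]_N) : (delta_mx 0 i *m C *m delta_mx j 0 : 'M[R]_1) 0 0 = C i j.
    by rewrite -rowE -colE !mxE.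
  have entl : herm_re (delta_mx 0 i *m delta y) (delta_mx 0 j) = (delta y *m herm_gram) i j.
    by rewrite herm_reE trmx_delta -(mulmxA _ (delta y)) ent.
  have entr : herm_re (delta_mx 0 i) (delta_mx 0 j *m delta y) = (herm_gram *m (delta y)^T) i j.
    by rewrite herm_reE trmx_mul trmx_delta mulmxA -(mulmxA _ herm_gram) ent.
  rewrite -entl [RHS]mxE -entr /herm_re herm_deltal herm_delta fs_conj_imaginary.
  by rewrite mulNr raddfN /= fs_reC.
have trN : \tr (delta y) = - \tr (delta y).
  rewrite -[in RHS]mxtrace_tr {1}(_ : delta y = - (herm_gram *m (delta y)^T *m invmx herm_gram)).
    by rewrite raddfN /= mxtrace_mulC mulmxA mulVmx ?herm_gram_unit // mul1mx.
  by rewrite -mulNmx -skew mulmxK ?herm_gram_unit.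
have tr0 : \tr (delta y) = 0.
  by apply/eqP; rewrite -[_ == _](mulrn_eq0 _ 2) mulr2n {1}trN addNr.
rewrite -{1}(subrK (fs_real t (fs_re x)) x) -/y raddfD /= mxtraceD tr0 add0r.
by rewrite delta_real mxtrace_scalar mulr_natl.
Qed.

(** Each summand has rank at most one: the column of the functional Re h(g u, -) times the row g w.
    Acting on row vectors from the right, the sum is the joint second moment operator of the orbits
    of u and w. *)
Definition orbit_moment u w : 'M[R]_N :=
  \sum_(g in G) (\col_i herm_re (lact g u) (delta_mx 0 i)) *m lact g w.

Lemma mulmx_orbit_moment u w v :
  v *m orbit_moment u w = \sum_(g in G) herm_re (lact g u) v *: lact g w.
Proof.
rewrite mulmx_sumr; apply: eq_bigr => g _; rewrite mulmxA -mul_scalar_mx; congr (_ *m _).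
rewrite [LHS]mx11_scalar; congr _%:M; rewrite mxE {2}[v]row_sum_delta herm_re_sumr.
by apply: eq_bigr => i _; rewrite herm_reZr mxE.
Qed.

(** Translating the summation variable by an element of G and using the invariance of h moves the
    action through the sum. *)
Lemma orbit_moment_centralizes u w : centgmx rG (orbit_moment u w).
Proof.
apply/centgmxP => k kG; apply/row_matrixP => i; rewrite !rowE !mulmxA.
have rGk v : v *m rG k = lact k^-1%g v by rewrite /Defs.lact invgK.
set v := delta_mx 0 i; rewrite !mulmx_orbit_moment !rGk lact_sum.
rewrite [RHS](reindex_inj (mulgI k^-1%g)) /=; apply: eq_big => [g|g gG].
  by rewrite groupMl // groupV.
rewrite !lactM ?groupV // /herm_re herm_lact ?groupV //.
by rewrite {1}/Defs.lact -scalemxAl.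
Qed.

Hypothesis rG_irr : mx_irreducible rG.

Lemma degree_gt0 : (0 < N)%N.
Proof. by case/mx_irrP: rG_irr. Qed.

(* By Schur's lemma the moment operator is a right multiplication by some s in D, and
   s is read off the traces tr (delta (s * c)). *)
Lemma orbit_moment_delta u w :
  orbit_moment u w = delta (fs_real t (#|G|%:R / N%:R) * h u w).
Proof.
have [s sE] : exists s, delta s = orbit_moment u w.
  by case: delta_iso => _ _ _ _ H; apply/H; exact: orbit_moment_centralizes.
have N0 : N%:R != 0 :> R by rewrite pnatr_eq0 -lt0n degree_gt0.
suff trs c : N%:R * fs_re (s * c) = #|G|%:R * fs_re (h u w * c).
  rewrite -sE; congr delta; apply/eqP; rewrite -subr_eq0; apply/eqP.
  apply: fs_re_nondegenerate => c; rewrite mulrBl raddfB /= -mulrA fs_reZ.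
  by apply: (mulfI N0); rewrite mulr0 mulrBr trs; field.
(* The trace of the moment operator followed by [delta c] is the sum over g of Re h(g u, g (w c)),
   and invariance makes each term Re h(u, w c). *)
rewrite -mxtrace_delta deltaM sE /orbit_moment mulmx_suml (raddf_sum mxtrace) /=.
rewrite -sum1_card natr_sum mulr_suml; apply: eq_bigr => g gG.
rewrite -mulmxA mxtrace_mulC -lact_delta // mul1r -herm_delta -(herm_lact u _ gG).
rewrite -/(herm_re _ _) {2}[lact g (w *m _)]row_sum_delta herm_re_sumr.
rewrite trace_mx11 mxE; apply: eq_bigr => i _.
by rewrite herm_reZr; congr (_ * _); rewrite mxE.
Qed.

Lemma sum_herm_re_lact u w v :
  \sum_(g in G) herm_re (lact g u) v *: lact g w =
  v *m delta (fs_real t (#|G|%:R / N%:R) * h u w).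
Proof. by rewrite -mulmx_orbit_moment orbit_moment_delta. Qed.

Hypothesis rG_nontriv : exists2 g, g \in G & rG g != 1%:M.

(** The sum is a fixed vector. Fixed vectors form a subrepresentation, which by irreducibility is 0
    or everything, and the latter would make the action trivial. *)
Lemma sum_lact v : \sum_(g in G) lact g v = 0.
Proof.
have fix0 : rfix_mx rG G = 0.
  case/mx_irrP: rG_irr => _ irr; apply/eqP/negPn/negP => /(irr _ (rfix_mx_module rG)).
  rewrite -sub1mx => /rfix_mxP fixG.
  by case: rG_nontriv => g gG; rewrite -(fixG g gG) mul1mx eqxx.
apply/eqP; rewrite -submx0 -fix0; apply/rfix_mxP => k kG.
have -> (x : V) : x *m rG k = lact k^-1%g x by rewrite /Defs.lact invgK.
rewrite lact_sum [RHS](reindex_inj (mulgI k^-1%g)) /=; apply: eq_big => [g|g gG].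
  by rewrite groupMl // groupV.
by rewrite lactM ?groupV.
Qed.

Hypothesis e_basis : orthonormal_Dbasis delta h e.

(** As h is D-linear in its second argument, pairing with the basis on the left reads off
    coordinates for the right D-module structure. *)
Definition Dcoord v : 'cV[D]_n := \col_i h (e i) v.
Definition Dvec (x : 'cV[D]_n) : V := \sum_i e i *m delta (x i 0).

Lemma DvecK : cancel Dvec Dcoord.
Proof.
move=> x; apply/colP => i; rewrite mxE raddf_sum (bigD1 i) //= big1 => [|j ji].
  by rewrite herm_delta e_basis.1 eqxx mul1r addr0.
by rewrite herm_delta e_basis.1 eq_sym (negbTE ji) mul0r.
Qed.

Lemma DcoordK : cancel Dcoord Dvec.
Proof.
move=> v; have [c vE] := e_basis.2 v.
have {1}-> : v = Dvec (\col_i c i) by rewrite vE; apply: eq_bigr => i _; rewrite mxE.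
by rewrite DvecK vE; apply: eq_bigr => i _; rewrite mxE.
Qed.

Lemma Dcoord_is_zmod_morphism : zmod_morphism Dcoord.
Proof. by move=> u v; apply/colP => i; rewrite !mxE raddfB. Qed.

HB.instance Definition _ :=
  GRing.isZmodMorphism.Build V ('cV[D]_n) Dcoord Dcoord_is_zmod_morphism.

(** The scalar is a 1 x 1 matrix on the right because [*:] multiplies on the left and D need not be
    commutative. *)
Lemma Dcoord_delta v x : Dcoord (v *m delta x) = Dcoord v *m x%:M.
Proof.
by apply/colP => i; rewrite !mxE herm_delta big_ord1 !mxE eqxx mulr1n.
Qed.

Lemma DcoordZ c v : Dcoord (c *: v) = scale_real c (Dcoord v).
Proof. by apply/colP => i; rewrite !mxE hermZr. Qed.

Lemma Dcoord_herm u v : adjmx (Dcoord u) *m Dcoord v = (h u v)%:M.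
Proof.
rewrite [LHS]mx11_scalar; congr _%:M; rewrite mxE -{2}(DcoordK v) raddf_sum /=.
by apply: eq_bigr => i _; rewrite !mxE herm_delta -herm_conj.
Qed.

Lemma Dcoord_lact g v : g \in G -> Dcoord (lact g v) = rho g *m Dcoord v.
Proof.
move=> gG; rewrite -{1}(DcoordK v) lact_sum raddf_sum /=; apply/colP => i.
rewrite !mxE summxE; apply: eq_bigr => j _.
by rewrite !mxE lact_delta // herm_delta.
Qed.

(** [Dcoord] is onto, so identities such as rho(gk) = rho(g) rho(k) can be checked on vectors of
    V. *)
Lemma mulmx_Dmatrix_col p (A B : 'M[D]_(p, n)) :
  (forall v, A *m Dcoord v = B *m Dcoord v) -> A = B.
Proof.
move=> AB; apply/matrixP => i j; have := AB (Dvec (delta_mx j 0)).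
by rewrite DvecK -!colE => /colP/(_ i); rewrite !mxE.
Qed.

Lemma Dmatrix1 : rho 1%g = 1%:M.
Proof. by apply: mulmx_Dmatrix_col => v; rewrite -Dcoord_lact // lact1 mul1mx. Qed.

Lemma DmatrixM g k : g \in G -> k \in G -> rho (g * k)%g = rho g *m rho k.
Proof.
move=> gG kG; apply: mulmx_Dmatrix_col => v.
by rewrite -Dcoord_lact ?groupM // lactM // -mulmxA -!Dcoord_lact.
Qed.

(** The columns of rho(g) are the coordinates of the g e_j, which stay orthonormal because h is
    invariant. *)
Lemma Dmatrix_unitary g : g \in G -> unitary_fs (rho g).
Proof.
move=> gG; apply/matrixP => i j; rewrite !mxE -e_basis.1 -(herm_lact _ _ gG).
have /matrixP/(_ 0 0) := Dcoord_herm (lact g (e i)) (lact g (e j)).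
by rewrite !mxE eqxx mulr1n => <-; apply: eq_bigr => k _; rewrite !mxE.
Qed.

Lemma ipmx_Dcoord u v : ipmx (Dcoord u) (Dcoord v) = herm_re u v.
Proof. by rewrite ipmx_tr Dcoord_herm mxtrace_scalar. Qed.

Lemma sum_Dmatrix m (M : 'M[D]_(n, m)) : \sum_(g in G) rho g *m M = 0.
Proof.
rewrite -mulmx_suml (_ : \sum_(g in G) rho g = 0) ?mul0mx //.
apply: mulmx_Dmatrix_col => v; rewrite mul0mx mulmx_suml.
transitivity (Dcoord (\sum_(g in G) lact g v)); last by rewrite sum_lact raddf0.
rewrite raddf_sum /=.
by apply: eq_bigr => g gG; rewrite Dcoord_lact.
Qed.

(** The moment identity of V in coordinates: the scalar h(u, w) becomes x^* y and multiplies z on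
    the right. *)
Lemma col_moment (x y z : 'cV[D]_n) :
  \sum_(g in G) scale_real (ipmx (rho g *m x) z) (rho g *m y) =
  scale_real (#|G|%:R / N%:R) (z *m adjmx x *m y).
Proof.
rewrite -(DvecK x) -(DvecK y) -(DvecK z); move: (Dvec x) (Dvec y) (Dvec z) => u w v.
rewrite -mulmxA Dcoord_herm -scale_real_mulr /scale_real scale_scalar_mx -Dcoord_delta.
rewrite -sum_herm_re_lact raddf_sum /=; apply: eq_bigr => g gG.
by rewrite DcoordZ -!Dcoord_lact // ipmx_Dcoord.
Qed.

Lemma ipmx_cols p q (A B : 'M[D]_(p, q)) : ipmx A B = \sum_k ipmx (col k A) (col k B).
Proof.
rewrite /ipmx exchange_big /=; apply: eq_bigr => k _; apply: eq_bigr => i _.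
by rewrite big_ord1 !mxE.
Qed.

(** The inner product splits over columns. Column l of the sum then follows from [col_moment]
    applied to column k of M, column l of M and column k of B, and the products of column k of B
    with the adjoint of column k of M add up to B M^*. *)
Lemma matrix_moment m (M B : 'M[D]_(n, m)) :
  \sum_(g in G) scale_real (ipmx (rho g *m M) B) (rho g *m M) =
  scale_real (#|G|%:R / N%:R) (B *m (adjmx M *m M)).
Proof.
have BM : B *m adjmx M = \sum_k col k B *m adjmx (col k M).
  apply/matrixP => i j; rewrite mxE summxE; apply: eq_bigr => k _.
  by rewrite !mxE big_ord1 !mxE.
have col_mul (A : 'M[D]_n) (C : 'M[D]_(n, m)) k : col k (A *m C) = A *m col k C.
  by rewrite !colE mulmxA.
have colsum l : \sum_k scale_real (#|G|%:R / N%:R) (col k B *m adjmx (col k M) *m col l M) =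
    \sum_(g in G) \sum_k scale_real (ipmx (rho g *m col k M) (col k B)) (rho g *m col l M).
  by rewrite exchange_big /=; apply: eq_bigr => k _; rewrite col_moment.
apply/matrixP => i l; rewrite mulmxA BM.
transitivity ((\sum_k scale_real (#|G|%:R / N%:R) (col k B *m adjmx (col k M) *m col l M)) i 0).
  rewrite colsum !summxE; apply: eq_bigr => g gG.
  rewrite mxE ipmx_cols rmorph_sum mulr_suml summxE /=; apply: eq_bigr => k _.
  by rewrite [RHS]mxE -col_mul; congr (_ * _); rewrite -col_mul [RHS]mxE.
rewrite mulmx_suml summxE mxE summxE mulr_sumr; apply: eq_bigr => k _.
by rewrite [LHS]mxE; congr (_ * _); rewrite -col_mul mxE.
Qed.

Lemma ipmx_moment m (M B C : 'M[D]_(n, m)) :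
  \sum_(g in G) ipmx (rho g *m M) B * ipmx (rho g *m M) C =
  ipmx C (scale_real (#|G|%:R / N%:R) (B *m (adjmx M *m M))).
Proof.
rewrite -matrix_moment ipmx_sumr; apply: eq_bigr => g _.
by rewrite ipmxZr (ipmxC C).
Qed.

(** With S = M^* M, nondegeneracy turns the moment condition into B S = const B for every B. So S is
    a real scalar matrix, and Re tr S, the squared norm of M, fixes the value 1/m. *)
Lemma moment_scalarP m (M : 'M[D]_(n, m)) : (0 < m)%N -> frobenius M = 1 ->
  (exists c, forall B C, \sum_(g in G) ipmx (rho g *m M) B * ipmx (rho g *m M) C =
     c * ipmx B C) <-> adjmx M *m M = scale_real m%:R^-1 1%:M.
Proof.
move=> m0 M1; have m0' : m%:R != 0 :> R by rewrite pnatr_eq0 -lt0n.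
have G0 : #|G|%:R != 0 :> R by rewrite pnatr_eq0 -lt0n cardG_gt0.
have N0 : N%:R != 0 :> R by rewrite pnatr_eq0 -lt0n degree_gt0.
split=> [[c momc]|MM]; last first.
  exists (#|G|%:R / N%:R / m%:R) => B C.
  by rewrite ipmx_moment MM scale_real_mulr mulmx1 !ipmxZr ipmxC mulrA.
set S := adjmx M *m M.
have SB (B : 'M[D]_(n, m)) : scale_real (#|G|%:R / N%:R) (B *m S) = scale_real c B.
  apply/eqP; rewrite -subr_eq0; apply/eqP/ipmx_nondegenerate => C.
  by rewrite ipmxC ipmxBr -ipmx_moment momc ipmxZr (ipmxC B) subrr.
(* Norm 1 excludes n = 0, which supplies a row index. *)
pose i := Ordinal (frobenius1_gt0 M1).
have SE : S = scale_real (c / (#|G|%:R / N%:R)) 1%:M.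
  (* Row i of [delta_mx i k *m S] is row k of S. *)
  apply/matrixP => k l; have /matrixP/(_ i l) := SB (delta_mx i k).
  have -> : (scale_real (#|G|%:R / N%:R) (delta_mx i k *m S)) i l =
            fs_real t (#|G|%:R / N%:R) * S k l.
    rewrite mxE; congr (_ * _); rewrite mxE (bigD1 k) //= mxE !eqxx mul1r.
    by rewrite big1 ?addr0 // => j jk; rewrite mxE (negbTE jk) andbF mul0r.
  have K0 : #|G|%:R / N%:R != 0 :> R by rewrite mulf_neq0 ?invr_eq0.
  move/(congr1 (fun x => fs_real t (#|G|%:R / N%:R)^-1 * x)).
  rewrite !mulrA -!rmorphM mulVf // rmorph1 mul1r => ->.
  by rewrite !mxE eqxx /= mulrA -rmorphM [_^-1 * c]mulrC eq_sym.
have : ipmx M M = 1 by rewrite -frobenius_sqr M1 expr1n.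
rewrite ipmx_tr -/S SE /scale_real mxtraceZ mxtrace1 fs_reZ.
rewrite -(rmorph_nat (@fs_real R t)).
by rewrite fs_re_real => e1; congr (fs_real t _ *: _); apply: (mulIf m0'); rewrite e1 mulVf.
Qed.

End HermitianRepresentation.

(** * Completing orthonormal columns to a unitary matrix *)

Section UnitaryCompletion.
Variables (R : realType) (t : fs_type).
Local Notation D := (fs_alg R t).

(** A dimension count over the reals: p equations over D in n unknowns are pd real equations in nd
    real unknowns. This sidesteps elimination over a noncommutative D; a nonzero solution is then
    normalized by a real factor. *)
Lemma exists_orthogonal p n (A : 'M[D]_(p, n)) : (p < n)%N ->
  exists2 w : 'cV[D]_n, A *m w = 0 & adjmx w *m w = 1%:M.
Proof.
move=> pn; have d0 : (0 < fs_dim t)%N by case: t.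
pose unvec (v : 'rV[R]_(n * 1 * fs_dim t)) : 'cV[D]_n := projT1 (cid (realvec_surj v)).
have unvecK v : realvec (unvec v) = v by rewrite /unvec; case: cid.
pose F v := realvec (A *m unvec v).
have F_lin : linear F.
  move=> c u v; rewrite /F -realvecZ -raddfD /= -scale_real_mulr -mulmxDr.
  congr (realvec (_ *m _)).
  by apply: realvec_inj; rewrite raddfD /= realvecZ !unvecK.
pose Flin := GRing.isLinear.Build _ _ _ _ F F_lin.
pose F' : {linear _ -> _} := HB.pack F Flin.
have : kermx (lin1_mx F') != 0.
  rewrite -mxrank_eq0 mxrank_ker -lt0n subn_gt0 (leq_ltn_trans (rank_leq_col _)) //.
  by rewrite ltn_pmul2r // !muln1.
case/rowV0Pn => v /sub_kermxP vF v0; pose w := unvec v.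
have Aw : A *m w = 0.
  by apply: realvec_inj; rewrite raddf0 -[LHS]/(F' v) -mul_rV_lin1.
have w0 : ipmx w w != 0.
  apply: contra v0 => /eqP/ipmx_eq0 w0.
  by rewrite -[v]unvecK -/w w0 raddf0.
exists (scale_real (Num.sqrt (ipmx w w))^-1 w).
  by rewrite scale_real_mulr Aw /scale_real scaler0.
rewrite adjmx_scale scale_real_mull scale_real_mulr scale_realA -invfM -expr2.
rewrite sqr_sqrtr ?ipmx_ge0 //.
have -> : adjmx w *m w = scale_real (ipmx w w) 1%:M.
  rewrite [LHS]mx11_scalar /scale_real scalemx1; congr _%:M; rewrite mxE /ipmx raddf_sum /=.
  by apply: eq_bigr => i _; rewrite big_ord1 !mxE -fs_normsqE fs_conj_mul.
by rewrite scale_realA mulVf // scale_real1.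
Qed.

(** Induction on n - k, adding one unit vector orthogonal to the previous ones. Indexing by [nat]
    keeps the type of the family fixed while it grows; only the values below k, then below n, are
    constrained. *)
Lemma orthonormal_extension n k (c : nat -> 'cV[D]_n) : (k <= n)%N ->
  (forall i j, (i < k)%N -> (j < k)%N -> adjmx (c i) *m c j = (i == j)%:R%:M) ->
  exists2 c' : nat -> 'cV[D]_n, (forall i, (i < k)%N -> c' i = c i) &
    forall i j, (i < n)%N -> (j < n)%N -> adjmx (c' i) *m c' j = (i == j)%:R%:M.
Proof.
move dk : (n - k)%N => d; elim: d k c dk => [|d IH] k c dk kn ortho.
  have nk : (n <= k)%N by rewrite -subn_eq0 dk.
  by exists c => // i j ilt jlt; apply: ortho; exact: leq_trans nk.
have kn' : (k < n)%N by rewrite -subn_gt0 dk.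
(* The rows are the adjoints of the vectors found so far, so the kernel is their orthogonal
   complement. *)
have [w w_orth ww] := exists_orthogonal (\matrix_(i < k, j < n) adjmx (c i) 0 j) kn'.
have cw i : (i < k)%N -> adjmx (c i) *m w = 0.
  move=> ik; rewrite [LHS]mx11_scalar; have /colP/(_ (Ordinal ik)) := w_orth.
  rewrite mxE [RHS]mxE => w0; rewrite -[RHS](raddf0 (@scalar_mx D 1)); congr _%:M.
  by rewrite mxE -[RHS]w0; apply: eq_bigr => j _; congr (_ * _); rewrite [RHS]mxE.
have wc i : (i < k)%N -> adjmx w *m c i = 0.
  by move=> ik; rewrite -[LHS]adjmxK adjmxM adjmxK cw // raddf0.
have [||c' c'E c'_orth] := IH k.+1 (fun i => if i == k then w else c i) _ kn'.
- by rewrite subnS dk.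
- move=> i j; rewrite !ltnS (leq_eqVlt i) (leq_eqVlt j).
  case: (eqVneq i k) => [->|ik] /=; case: (eqVneq j k) => [->|jk] //= ilt jlt.
  + by rewrite wc ?raddf0.
  + by rewrite (negbTE ik) cw ?raddf0.
  + exact: ortho.
exists c' => // i ik; rewrite c'E ?(ltn_trans ik) //.
by rewrite (ltn_eqF ik).
Qed.

Lemma unitary_completion n m (hmn : (m <= n)%N) (M : 'M[D]_(n, m)) :
  adjmx M *m M = 1%:M -> exists2 U : 'M[D]_n, unitary_fs U & first_cols hmn U = M.
Proof.
(* The default 0 fills the indices from m on, which the extension is free to replace. *)
move=> MM; pose c i : 'cV[D]_n := if insub i is Some j then col j M else 0.
have cE (j : 'I_m) : c j = col j M by rewrite /c valK.
have [|c' c'E c'_orth] := orthonormal_extension (c := c) hmn.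
  move=> i j im jm; rewrite (cE (Ordinal im)) (cE (Ordinal jm)).
  rewrite [LHS]mx11_scalar; congr _%:M; have /matrixP/(_ (Ordinal im) (Ordinal jm)) := MM.
  by rewrite !mxE => <-; apply: eq_bigr => k _; rewrite !mxE.
exists (\matrix_(i, j) c' j i 0).
  apply/matrixP => i j; have /matrixP/(_ 0 0) := c'_orth i j (ltn_ord i) (ltn_ord j).
  by rewrite !mxE eqxx mulr1n => <-; apply: eq_bigr => k _; rewrite !mxE.
by apply/matrixP => i j; rewrite !mxE /= c'E // cE mxE.
Qed.

End UnitaryCompletion.

(** * Spherical designs formed by matrix orbits *)

Section OrbitDesigns.
Variables (R : realType) (gT : finGroupType) (G : {group gT}).
Variables (t : fs_type) (N n : nat) (rG : mx_representation R G N).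
Local Notation D := (fs_alg R t).
Local Notation V := 'rV[R]_N.
Variables (delta : D -> 'M[R]_N) (h : V -> V -> D) (e : 'I_n -> V).
Hypothesis rG_irr : mx_irreducible rG.
Hypothesis rG_nontriv : exists2 g, g \in G & rG g != 1%:M.
Hypothesis delta_iso : fs_iso rG delta.
Hypothesis h_herm : invariant_hermitian rG delta h.
Hypothesis e_basis : orthonormal_Dbasis delta h e.
Local Notation rho := (Dmatrix rG h e).

(** The orbit is a set, while group sums count its points with multiplicity; the fibres of g |->
    rho(g) M are the left cosets of the stabilizer of M, all of one size. *)
Lemma orbit_mean m (M : 'M[D]_(n, m)) f :
  set_mean (@realvec R t n m @` orbit_mx G rho M) f =
  #|G|%:R^-1 * \sum_(g in G) f (realvec (rho g *m M)).
Proof.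
have -> : @realvec R t n m @` orbit_mx G rho M =
    (fun g => realvec (rho g *m M)) @` [set` (G : {set gT})].
  apply/seteqP; split=> x /=; first by case=> _ [g gG ->] <-; exists g.
  by case=> g gG <-; exists (rho g *m M) => //; exists g.
apply: (set_mean_image (k := #|[set g in G | rho g *m M == M]|)); first exact: cardG_gt0.
(* Left multiplication by [a] carries the stabilizer of M onto the fibre through [a]. *)
move=> a aG; rewrite -[RHS](card_imset _ (mulgI a)); apply: eq_card => b.
have rhoK c : c \in G -> (rho (a * c)%g *m M == rho a *m M) = (rho c *m M == M).
  move=> cG; rewrite (DmatrixM delta_iso h_herm e_basis) // -mulmxA.
  apply/eqP/eqP => [|-> //] /(congr1 (mulmx (adjmx (rho a)))).
  by rewrite !mulmxA (Dmatrix_unitary h_herm e_basis aG) !mul1mx.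
rewrite inE /= (inj_eq (@realvec_inj _ _ _ _)); apply/andP/imsetP => [[bG bM]|[c]].
  exists (a^-1 * b)%g; rewrite ?mulKVg // inE groupM ?groupV //= -rhoK ?mulKVg //.
  by rewrite groupM ?groupV.
by rewrite inE => /andP[cG cM] ->; rewrite groupM // rhoK.
Qed.

Lemma orbit_finite m (M : 'M[D]_(n, m)) : finite_set (@realvec R t n m @` orbit_mx G rho M).
Proof.
apply: finite_image; apply: (sub_finite_set (B := (fun g => rho g *m M) @` [set: gT])).
  by move=> _ [g gG ->]; exists g.
by apply: finite_image; exact: finite_finset.
Qed.

Let cardG_neq0 : #|G|%:R != 0 :> R.
Proof. by rewrite pnatr_eq0 -lt0n cardG_gt0. Qed.

(** Stated for a subspace E because it serves both the full matrix space and a subrepresentation;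
    the second moment of the sphere of E is known to be scalar on E. *)
Lemma orbit_design_moment m (E : {vspace 'rV[R]_(n * m * fs_dim t)})
    (mu : probability (borel_rV R (n * m * fs_dim t)) R) (M : 'M[D]_(n, m)) :
  uniform_on_sphere E mu ->
  spherical_design E mu 2 (@realvec R t n m @` orbit_mx G rho M) ->
  exists c, forall B C, realvec B \in E -> realvec C \in E ->
    \sum_(g in G) ipmx (rho g *m M) B * ipmx (rho g *m M) C = c * ipmx B C.
Proof.
move=> mu_unif des; have [c cE] := sphere_mean_dotv2 mu_unif.
exists (#|G|%:R * c) => B C BE CE.
have := spherical_design_moment2 (realvec B) (realvec C) des.
rewrite cE // orbit_mean dotv_realvec => /(congr1 ( *%R #|G|%:R)).
rewrite mulVKf // mulrA => <-.
by apply: eq_bigr => g _; rewrite !dotv_realvec.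
Qed.

Lemma orbit_mx_refl m (M : 'M[D]_(n, m)) : orbit_mx G rho M M.
Proof. by exists 1%g; rewrite ?group1 // (Dmatrix1 delta_iso h_herm e_basis) mul1mx. Qed.

Lemma ipmx_Dmatrix g m (A B : 'M[D]_(n, m)) :
  g \in G -> ipmx (rho g *m A) (rho g *m B) = ipmx A B.
Proof. by move=> gG; apply: ipmx_mulmxl; exact: (Dmatrix_unitary h_herm e_basis gG). Qed.

(** The second moments of orbit and sphere are scalars, c / |G| and c'. Both have trace 1, all
    points being unit vectors, so the scalars agree; both first moments vanish. *)
Lemma moment_orbit_design m (mu : probability (borel_rV R (n * m * fs_dim t)) R)
    (M : 'M[D]_(n, m)) c :
  uniform_on_sphere fullv mu -> frobenius M = 1 ->
  (forall B C, \sum_(g in G) ipmx (rho g *m M) B * ipmx (rho g *m M) C = c * ipmx B C) ->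
  spherical_design fullv mu 2 (@realvec R t n m @` orbit_mx G rho M).
Proof.
move=> mu_unif M1 cM; have [c' c'E] := sphere_mean_dotv2 mu_unif.
set X := _ @` _; have finX : finite_set X := orbit_finite M.
have MM : ipmx M M = 1 by rewrite -frobenius_sqr M1 expr1n.
have XS : X `<=` unit_sphere fullv.
  move=> _ [_ [g gG ->] <-]; split; first exact: memvf.
  by rewrite dotv_realvec ipmx_Dmatrix.
have coordE i : exists B : 'M[D]_(n, m), realvec B = delta_mx 0 i by exact: realvec_surj.
have coord_ip i B (A : 'M[D]_(n, m)) : realvec B = delta_mx 0 i -> realvec A 0 i = ipmx A B.
  by move=> BE; rewrite -dotv_delta -BE dotv_realvec.
have coord2E i j : set_mean X (fun x => x 0 i * x 0 j) = c / #|G|%:R * (i == j)%:R.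
  have [[B BE] [C CE]] := (coordE i, coordE j); rewrite orbit_mean.
  under eq_bigr do rewrite (coord_ip _ _ _ BE) (coord_ip _ _ _ CE).
  rewrite cM mulrA [_^-1 * c]mulrC; congr (_ * _).
  by rewrite -dotv_realvec BE CE dotv_delta mxE eqxx eq_sym.
have mean2E i j : sphere_mean fullv mu (fun x => x 0 i * x 0 j) = c' * (i == j)%:R.
  under eq_fun do rewrite -(dotv_delta _ i) -(dotv_delta _ j).
  by rewrite c'E ?memvf // dotv_delta mxE eqxx eq_sym.
have dX : c / #|G|%:R * (n * m * fs_dim t)%:R = 1.
  transitivity (set_mean X (fun x => \sum_i 1 * (x 0 i * x 0 i))).
    rewrite set_mean_sum //; under eq_bigr do rewrite coord2E eqxx !(mulr1, mul1r).
    by rewrite sumr_const card_ord mulr_natr.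
  rewrite orbit_mean (eq_bigr (fun=> 1)) => [|g gG]; first by rewrite sumr_const mulVf.
  under eq_bigr do rewrite mul1r.
  by rewrite -/(dotv _ _) dotv_realvec ipmx_Dmatrix.
have dmu : c' * (n * m * fs_dim t)%:R = 1.
  rewrite -[RHS](sphere_mean1 mu_unif).
  transitivity (sphere_mean fullv mu (fun x => \sum_i x 0 i * x 0 i)).
    rewrite sphere_mean_sum => [|i]; last first.
      exact: sphere_boundedM (sphere_bounded_coord _ _) (sphere_bounded_coord _ _).
    by under eq_bigr do rewrite mean2E eqxx mulr1; rewrite sumr_const card_ord mulr_natr.
  by apply: eq_Rintegral => x /set_mem[].
(* In dimension 0 the trace identity [dmu] would read 0 = 1. *)
have d0 : (n * m * fs_dim t)%:R != 0 :> R.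
  by apply: contra_eq_neq dmu => ->; rewrite mulr0 eq_sym oner_eq0.
have cc' : c / #|G|%:R = c' by apply: (mulIf d0); rewrite dX dmu.
apply: spherical_design2 => //.
- by exists (realvec M), M => //; exact: orbit_mx_refl.
- move=> i; have [B BE] := coordE i; rewrite orbit_mean.
  under eq_bigr do rewrite (coord_ip _ _ _ BE) ipmxC.
  under [in RHS]eq_fun do rewrite -(dotv_delta _ i).
  rewrite (sphere_mean_dotv mu_unif) -ipmx_sumr.
  rewrite (sum_Dmatrix delta_iso h_herm rG_irr rG_nontriv e_basis).
  by rewrite -dotv_realvec raddf0 dotv0 mulr0.
- by move=> i j; rewrite coord2E mean2E cc'.
Qed.

Lemma full_design_iff m (mu : probability (borel_rV R (n * m * fs_dim t)) R)
    (M : 'M[D]_(n, m)) :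
  (0 < m)%N -> uniform_on_sphere fullv mu -> frobenius M = 1 ->
  spherical_design fullv mu 2 (@realvec R t n m @` orbit_mx G rho M) <->
  adjmx M *m M = scale_real m%:R^-1 1%:M.
Proof.
move=> m0 mu_unif M1.
rewrite -(moment_scalarP delta_iso h_herm rG_irr e_basis m0 M1).
split=> [des|[c cM]]; last exact: (moment_orbit_design mu_unif M1 cM).
have [c cM] := orbit_design_moment mu_unif des.
by exists c => B C; rewrite cM ?memvf.
Qed.

(** The scalar moment condition is what passes through [phi], which preserves inner products and
    intertwines the actions; its surjectivity supplies all test matrices. *)
Lemma design_transport m (W : {vspace 'rV[R]_(n * n * fs_dim t)})
    (mu : probability (borel_rV R (n * n * fs_dim t)) R)
    (phi : 'M[D]_n -> 'M[D]_(n, m)) (A : 'M[D]_n) :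
  subrep G rho W -> uniform_on_sphere W mu -> (0 < m)%N ->
  equivariant_isometry G rho W phi -> realvec A \in W ->
  spherical_design W mu 2 (@realvec R t n n @` orbit_mx G rho A) ->
  adjmx (phi A) *m phi A = scale_real m%:R^-1 1%:M.
Proof.
move=> W_sub mu_unif m0 [phiD phiZ phi_iso phi_surj phi_rho] AW des.
(* Polarization: preservation of norms, applied to B + C, gives preservation of inner products. *)
have iso2 B C : realvec B \in W -> realvec C \in W -> ipmx (phi B) (phi C) = ipmx B C.
  move=> BW CW; have BCW : realvec (B + C) \in W by rewrite raddfD memvD.
  have sqr X : realvec X \in W -> ipmx (phi X) (phi X) = ipmx X X.
    by move=> XW; rewrite -!frobenius_sqr phi_iso.
  have := sqr _ BCW; rewrite phiD // !ipmxDl !ipmxDr !sqr // (ipmxC C) (ipmxC (phi C)).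
  by lra.
have A1 : frobenius A = 1.
  case: des => _ _ XS _; have [_] : unit_sphere W (realvec A).
    by apply: XS; exists A => //; exact: orbit_mx_refl.
  by rewrite dotv_realvec frobeniusE => ->; rewrite sqrtr1.
have phiA1 : frobenius (phi A) = 1 by rewrite phi_iso.
apply/(moment_scalarP delta_iso h_herm rG_irr e_basis m0 phiA1).
have [c cA] := orbit_design_moment mu_unif des; exists c => B' C'.
have [B BW <-] := phi_surj B'; have [C CW <-] := phi_surj C'.
rewrite iso2 // -cA //; apply: eq_bigr => g gG.
by rewrite -!phi_rho // !iso2 //; exact: W_sub.
Qed.

End OrbitDesigns.

(** * The design criterion, its square case, and design orbits in subrepresentations *)

Theorem theorem3p7 (R : realType) (gT : finGroupType) (G : {group gT})
    (t : fs_type) (N n : nat) (rG : mx_representation R G N)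
    (delta : fs_alg R t -> 'M[R]_N)
    (h : 'rV[R]_N -> 'rV[R]_N -> fs_alg R t)
    (e : 'I_n -> 'rV[R]_N)
    (rG_irr : mx_irreducible rG)
    (rG_nontriv : exists2 g, g \in G & rG g != 1%:M)
    (delta_iso : fs_iso rG delta)
    (h_herm : invariant_hermitian rG delta h)
    (e_basis : orthonormal_Dbasis delta h e) :
  let rho := Dmatrix rG h e in
  [/\ forall m, (0 < m <= n)%N ->
        forall mu : probability (borel_rV R (n * m * fs_dim t)) R,
        uniform_on_sphere fullv mu ->
        forall M : 'M[fs_alg R t]_(n, m), frobenius M = 1 ->
        spherical_design fullv mu 2 (@realvec R t n m @` orbit_mx G rho M) <->
        adjmx M *m M = scale_real m%:R^-1 1%:M,
      forall mu : probability (borel_rV R (n * n * fs_dim t)) R,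
        uniform_on_sphere fullv mu ->
        forall M : 'M[fs_alg R t]_n, frobenius M = 1 ->
        spherical_design fullv mu 2 (@realvec R t n n @` orbit_mx G rho M) <->
        exists2 U, unitary_fs U & M = scale_real (Num.sqrt n%:R)^-1 U &
      forall W : {vspace 'rV[R]_(n * n * fs_dim t)},
        subrep G rho W -> W != 0%VS ->
        forall mu : probability (borel_rV R (n * n * fs_dim t)) R,
        uniform_on_sphere W mu ->
        forall m, (0 < m)%N -> forall hmn : (m <= n)%N,
        forall phi : 'M[fs_alg R t]_n -> 'M[fs_alg R t]_(n, m),
        equivariant_isometry G rho W phi ->
        forall A : 'M[fs_alg R t]_n, realvec A \in W ->
        spherical_design W mu 2 (@realvec R t n n @` orbit_mx G rho A) ->
        exists2 U, unitary_fs U &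
          phi @` orbit_mx G rho A =
          first_cols hmn @`
            [set B | exists2 g, g \in G &
                     B = scale_real (Num.sqrt m%:R)^-1 (rho g *m U)]].

Proof.
move=> rho; split.
- move=> m /andP[m0 _] mu mu_unif M M1.
  exact: (full_design_iff rG_irr rG_nontriv delta_iso h_herm e_basis m0 mu_unif M1).
- move=> mu mu_unif M M1.
  have n0 := frobenius1_gt0 M1.
  rewrite (full_design_iff rG_irr rG_nontriv delta_iso h_herm e_basis n0 mu_unif M1).
  set s := Num.sqrt n%:R; have s0 : s != 0 by rewrite sqrtr_eq0 -ltNge ltr0n.
  have ss : s * s = n%:R by rewrite -expr2 sqr_sqrtr // ler0n.
  split=> [MM|[U UU ->]].
    exists (scale_real s M); last by rewrite scale_realA mulVf // scale_real1.
    rewrite /unitary_fs adjmx_scale scale_real_mull scale_real_mulr MM !scale_realA.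
    by rewrite ss mulfV ?scale_real1 // pnatr_eq0 -lt0n.
  by rewrite adjmx_scale scale_real_mull scale_real_mulr UU scale_realA -invfM ss.
- move=> W W_sub _ mu mu_unif m m0 hmn phi phi_iso A AW des.
  have AA := design_transport rG_irr delta_iso h_herm e_basis W_sub mu_unif m0 phi_iso AW des.
  set s := Num.sqrt m%:R; have s0 : s != 0 by rewrite sqrtr_eq0 -ltNge ltr0n.
  have ss : s * s = m%:R by rewrite -expr2 sqr_sqrtr // ler0n.
  have [|U UU UM] := unitary_completion hmn (M := scale_real s (phi A)).
    rewrite adjmx_scale scale_real_mull scale_real_mulr AA !scale_realA.
    by rewrite ss mulfV ?scale_real1 // pnatr_eq0 -lt0n.
  exists U => //.
  (* Keeping the first m columns commutes with left multiplication by rho(g), so the two orbits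
     agree element by element. *)
  have colsE g : first_cols hmn (scale_real s^-1 (rho g *m U)) = rho g *m phi A.
    rewrite -scale_real_mulr /first_cols -mulmx_colsub.
    have -> : colsub (widen_ord hmn) (scale_real s^-1 U) = scale_real s^-1 (first_cols hmn U).
      by apply/matrixP => i j; rewrite !mxE.
    by rewrite UM scale_realA mulVf // scale_real1.
  have [_ _ _ _ phi_rho] := phi_iso.
  apply/seteqP; split=> B /=.
    case=> _ [g gG ->] <-; exists (scale_real s^-1 (rho g *m U)); first by exists g.
    by rewrite colsE -phi_rho.
  by case=> _ [g gG ->] <-; exists (rho g *m A); [exists g|rewrite phi_rho // colsE].
Qed.
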